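(* In the randomized call-once (CO) model with $n$ agents, asymptotically almost surely (as $n\to\infty$): 1. the number of calls until two fixed agents exchange their secrets is $\frac12 n\log n\cdot(1+o(1))$; 2. the number of calls until at least one of the agents becomes an expert is $n\log n\cdot(1+o(1))$; 3. the number of calls until a fixed agent becomes an expert is $n\log n\cdot(1+o(1))$; 4. the number of calls until all agents become experts is $\frac32 n\log n\cdot(1+o(1))$.
   Context: There are $n$ agents, each initially knowing a single distinct secret. Agents communicate by a sequence of calls between pairs of distinct agents; in each call the two agents exchange all secrets they currently know. An agent who knows all $n$ secrets is an expert. Two fixed agents have exchanged their secrets once each knows the secret of the other. In the randomized call-once (CO) model, each next call is between a pair of agents chosen uniformly at random among all pairs of distinct agents that have not called each other before (so every pair calls at most once, and the sequence of calls is a uniformly random ordering of all $\binom n2$ pairs). $\log$ is the natural logarithm. A statement ''$X=f(n)(1+o(1))$ a.a.s.'' means that for every $\delta>0$, $\mathbb P[(1-\delta)f(n)\le X\le(1+\delta)f(n)]\to1$ as $n\to\infty$. *)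

(* Defs.v *)
From HB Require Import structures.
From mathcomp Require Import all_boot all_order all_algebra.
From mathcomp Require Import all_classical all_reals all_analysis.
Set Implicit Arguments.
Unset Strict Implicit.
Unset Printing Implicit Defensive.
Import Order.TTheory GRing.Theory Num.Theory.
Import numFieldNormedType.Exports.
Local Open Scope ring_scope.

(* The agents are the elements of 'I_n, the secret of an agent is identified  *)
(* with that agent, and a call is a set of two agents.                        *)

Section Gossip.
Variable n : nat.

Definition knowledge := {ffun 'I_n -> {set 'I_n}}.

Definition init_knowledge : knowledge := [ffun a => [set a]%SET].

Definition make_call (K : knowledge) (e : {set 'I_n}) : knowledge :=
  [ffun a => if a \in e then \bigcup_(b in e) K b else K a]%SET.

Definition knowledge_after (s : seq {set 'I_n}) : knowledge :=
  foldl make_call init_knowledge s.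

Definition expert (a : 'I_n) (K : knowledge) : bool := K a == [set: 'I_n]%SET.

Definition exchanged (a b : 'I_n) (K : knowledge) : bool :=
  (b \in K a) && (a \in K b).

Definition some_expert (K : knowledge) : bool := [exists a, expert a K].

Definition all_experts (K : knowledge) : bool := [forall a, expert a K].

(* The least t such that Q holds after the first t calls of s, or             *)
(* (size s).+1 if there is none, which by all_experts_end does not happen for *)
(* the four properties above once s contains all the pairs.                   *)
Definition calls_until (Q : pred knowledge) (s : seq {set 'I_n}) : nat :=
  find (fun t : nat => Q (knowledge_after (take t s))) (iota 0 (size s).+1).

Definition pairs : {set {set 'I_n}} := [set e : {set 'I_n} | #|e| == 2]%SET.

Definition available (s : seq {set 'I_n}) : {set {set 'I_n}} :=
  [set e in pairs | e \notin s]%SET.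

Definition co_seq := 'C(n, 2).-tuple {set 'I_n}.

Variable R : realType.

Definition co_step (s : seq {set 'I_n}) (e : {set 'I_n}) : R :=
  if e \in available s then #|available s|%:R^-1 else 0.

Definition co_mass (s : co_seq) : R :=
  \prod_(i < 'C(n, 2)) co_step (take i s) (tnth s i).

Definition co_prob (A : pred co_seq) : R := \sum_(s | A s) co_mass s.

End Gossip.

Arguments co_prob {n R} A.

(* X n is a random variable of the model with n.+2 agents (so that two        *)
(* distinct agents exist); f is a function of the number of agents.           *)
Definition aas_asymp (R : realType) (X : forall n, co_seq n.+2 -> nat)
    (f : nat -> R) : Prop :=
  forall delta : R, 0 < delta ->
    ((fun n : nat => co_prob (fun s : co_seq n.+2 =>
        ((1 - delta) * f n.+2 <= (X n s)%:R <= (1 + delta) * f n.+2)%R) : R)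
      @ \oo --> (1 : R))%classic.

Lemma card_pairs n : #|pairs n| = 'C(n, 2).
Proof. by rewrite card_draws card_ord. Qed.

Lemma co_massE n (R : realType) (s : co_seq n) :
  co_mass R s = if all (mem (pairs n)) s && uniq s then ('C(n, 2))`!%:R^-1 else 0.
Proof.
rewrite /co_mass; case: ifPn => [/andP[/allP sP us]|].
  have -> : ('C(n, 2))`!%:R^-1 = \prod_(i < 'C(n, 2)) ('C(n, 2) - i)%:R^-1 :> R.
    by rewrite -ffactnn ffact_prod natr_prod prodfV.
  apply: eq_bigr => i _; rewrite /co_step.
  have ilt : (i < size s)%N by rewrite size_tuple.
  have -> : #|available (take i s)| = ('C(n, 2) - i)%N.
    have -> : available (take i s) = (pairs n :\: [set e in take i s])%SET.
      by apply/setP => e; rewrite !inE andbC.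
    rewrite cardsD card_pairs; congr (_ - _)%N.
    have -> : (pairs n :&: [set e in take i s])%SET = [set e in take i s]%SET.
      apply/finset.setIidPr/fintype.subsetP => e; rewrite inE => /mem_take; exact: sP.
    by rewrite cardsE (card_uniqP (take_uniq i us)) size_take ilt.
  have sPi : tnth s i \in pairs n by apply: sP; apply: mem_tnth.
  rewrite inE sPi /= (tnth_nth (tnth s i)).
  have := us; rewrite -{1}(cat_take_drop i s) (drop_nth (tnth s i)) //.
  by rewrite cat_uniq /= negb_or => /and3P[_ /andP[/negPf-> _] _].
move=> bad; apply/eqP; rewrite prodf_seq_eq0; apply: contraR bad => /hasPn H.
have {}H (i : 'I_('C(n, 2))) : tnth s i \in available (take i s).
  have := H i (mem_index_enum _); rewrite /co_step /=.
  by case: ifP => //; rewrite eqxx.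
apply/andP; split.
  by apply/all_tnthP => i; have := H i; rewrite inE => /andP[].
apply/(uniqP (finset.set0)) => i j; rewrite !inE !size_tuple => iN jN.
wlog ij : i j iN jN / (i < j)%N => [W|].
  by case: (ltngtP i j) => // [/W|/W W' /esym] h; [apply: h|symmetry; apply: W'].
have := H (Ordinal jN); rewrite inE => /andP[_ /=].
rewrite (tnth_nth finset.set0) /= => /negP nin eij; case: nin; rewrite -eij.
rewrite -(nth_take _ ij); apply: mem_nth.
by rewrite size_take size_tuple jN.
Qed.

Lemma co_prob_unif n (R : realType) (A : pred (co_seq n)) :
  co_prob A = #|[set s : co_seq n | A s && (all (mem (pairs n)) s && uniq s)]%SET|%:R
              / ('C(n, 2))`!%:R :> R.
Proof.
rewrite /co_prob -sum1_card natr_sum big_distrl /= [RHS]big_mkcond /=.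
rewrite [LHS]big_mkcond /=; apply: eq_bigr => s _; rewrite co_massE inE.
by case: (A s) => //=; case: ifP; rewrite ?mul1r.
Qed.

Lemma co_prob_total n (R : realType) : co_prob (fun _ : co_seq n => true) = 1 :> R.
Proof.
rewrite co_prob_unif /= (card_uniq_tuples 'C(n, 2) (mem (pairs n))) card_pairs.
by rewrite ffactnn divff // pnatr_eq0 -lt0n fact_gt0.
Qed.

Lemma make_call_mono n (K : knowledge n) e a : K a \subset make_call K e a.
Proof. by rewrite ffunE; case: ifP => // ae; apply: finset.bigcup_sup. Qed.

Lemma foldl_make_call_mono n (s : seq {set 'I_n}) (K : knowledge n) a :
  K a \subset foldl (@make_call n) K s a.
Proof.
elim: s K => //= e s IH K.
exact: fintype.subset_trans (make_call_mono K e a) (IH _).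
Qed.

Lemma all_experts_end n (s : seq {set 'I_n}) :
  {subset pairs n <= s} -> all_experts (knowledge_after s).
Proof.
move=> sP; apply/forallP => a; rewrite /expert -finset.subTset.
apply/fintype.subsetP => b _; rewrite /knowledge_after.
have self (s' : seq {set 'I_n}) c : c \in foldl (@make_call n) (init_knowledge n) s' c.
  apply: (fintype.subsetP (foldl_make_call_mono s' _ c)).
  by rewrite ffunE finset.set11.
have [->|ab] := eqVneq b a; first exact: self.
have /sP : [set a; b]%SET \in pairs n by rewrite inE cards2 (eq_sym a) ab.
case/splitPr => s1 s2; rewrite foldl_cat /=.
apply: (fintype.subsetP (foldl_make_call_mono s2 _ a)).
rewrite ffunE finset.set21; apply/finset.bigcupP; exists b; first exact: finset.set22.
exact: self.
Qed.

Lemma calls_until_le n (Q : pred (knowledge n)) (s : seq {set 'I_n}) :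
  Q (knowledge_after s) -> (calls_until Q s <= size s)%N.
Proof.
move=> Qs; rewrite /calls_until -ltnS -[X in (_ < X)%N](size_iota 0) -has_find.
by apply/hasP; exists (size s); rewrite ?mem_iota ?ltnSn ?take_size.
Qed.

(* Main.v *)
Require Import Defs.
From mathcomp Require Import all_boot all_order all_algebra.
From mathcomp Require Import all_classical all_reals all_analysis.
(* Reimported so that [set0], [setT], [subsetP], ... refer to finite sets. *)
From mathcomp Require Import fintype finset.
From mathcomp Require Import ring lra zify.
Set Implicit Arguments.
Unset Strict Implicit.
Unset Printing Implicit Defensive.
Import Order.TTheory GRing.Theory Num.Theory.
Import numFieldNormedType.Exports.
Local Open Scope classical_set_scope.
Local Open Scope set_scope.
Local Open Scope ring_scope.

(** Every estimate comes from a nonnegative potential [phi] of the past calls. If its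
    drift, the sum of its increments over the available calls, is at most [r * phi],
    then the expectation of [phi] after [m] calls is at most [expR (m * r / (N - m))]
    times its initial value, where [N] is the number of pairs, and Markov's inequality
    bounds the probability that [phi] is large. Write [X] for the set of agents that
    know the secret of [a].

    - Lower bounds. [eps * n * (b \in X) + #|X|] grows at the rate [(1 + eps) * n],
      which bounds the probability that [b] knows the secret of [a]. The product of
      the [(#|X| + i) / (n - #|X| + 1 + i)] over [i < k] grows at the rate
      [k * (n + k)] whatever the size of [X], and goes from about [n ^- k] to about
      [n ^+ k] while [X] goes from one agent to all of them; with [k] large the
      resulting bound survives a union over the agents. Reversing the order of the
      calls exchanges "[a] is an expert" and "all know the secret of [a]". Finally,
      if [I] is the set of agents without any call, [1 / (#|I| + 1)] grows at the
      rate [n]: after almost [n log n / 2] calls there still is such an agent, whose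
      secret then needs almost [n log n] further calls.
    - Upper bounds. While all degrees are at most [eps * n], the potential
      [(b \notin X) / (#|X| - 1)] (with value [1 / eps] when [#|X| = 1]) decays at a
      rate close to [n], so that [b] fails to know the secret of [a] after
      [c * n log n] calls with probability about [n] to the power [1 - 2 * c]. This
      is [o(n ^- j)] for [c > (j + 1) / 2]; the cases [j = 0, 1, 2] give the upper
      bounds by summing over the two agents, over the secrets, and over all pairs. *)

Local Notation history n := (seq {set 'I_n}).

(** * Expectations along the random sequence of calls *)

Lemma big_tuple_cons (R : Type) (idx : R) (op : Monoid.com_law idx) (T : finType) k
    (P : pred (seq T)) (F : seq T -> R) :
  \big[op/idx]_(t : k.+1.-tuple T | P t) F t =
  \big[op/idx]_x \big[op/idx]_(t : k.-tuple T | P (x :: t)) F (x :: t).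
Proof.
rewrite pair_big_dep /= (reindex (fun p : T * k.-tuple T => [tuple of p.1 :: p.2])) //=.
exists (fun t : k.+1.-tuple T => (thead t, [tuple of behead t])) => [[x t] _|t _] /=.
  by congr (_, _); apply: val_inj.
by apply: val_inj => /=; rewrite [t in RHS]tuple_eta.
Qed.

Section Expectation.
Variables (n : nat) (R : realType).
Implicit Types (s t : history n) (e : {set 'I_n}) (F G phi : history n -> R).
Implicit Types (A B : pred (history n)).

Definition valid s := all (mem (pairs n)) s && uniq s.

Lemma valid_rcons s e : valid (rcons s e) = (e \in available s) && valid s.
Proof. by rewrite /valid all_rcons rcons_uniq [e \in available s]inE andbACA. Qed.

Lemma valid_catl s t : valid (s ++ t) -> valid s.
Proof. by rewrite /valid all_cat cat_uniq => /andP[/andP[-> _] /andP[-> _]]. Qed.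

Lemma card_available s : valid s -> #|available s| = ('C(n, 2) - size s)%N.
Proof.
move=> /andP[/allP s_pairs s_uniq].
have -> : available s = pairs n :\: [set e in s].
  by apply/setP => e; rewrite !inE andbC.
rewrite cardsD card_pairs (_ : pairs n :&: [set e in s] = [set e in s]).
  by rewrite cardsE (card_uniqP s_uniq).
by apply/setIidPr/subsetP => e; rewrite inE => /s_pairs.
Qed.

Lemma card_available_gt0 s : valid s -> (size s < 'C(n, 2))%N -> (0 < #|available s|)%N.
Proof. by move=> s_valid s_lt; rewrite card_available // subn_gt0. Qed.

(* The mean of [F] after [k] more calls (junk value 0 if they run out before). *)
Fixpoint expect k s F : R :=
  if k is k'.+1 then
    (\sum_(e in available s) expect k' (rcons s e) F) / #|available s|%:R
  else F s.

Definition pr k s A : R := expect k s (fun s' => (A s')%:R).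

Lemma expect_uniform k s F : valid s ->
  expect k s F =
  (\sum_(t : k.-tuple {set 'I_n} | valid (s ++ t)) F (s ++ t))
    / (('C(n, 2) - size s) ^_ k)%:R.
Proof.
elim: k s => [|k IH] s s_valid /=.
  rewrite (big_pred1 [tuple]) ?cats0 ?divr1 // => t.
  by rewrite tuple0 /= cats0 s_valid eqxx.
rewrite (big_tuple_cons _ k (fun t => valid (s ++ t)) (fun t => F (s ++ t))).
rewrite ffactnS natrM invfM mulrA mulrAC -card_available //; congr (_ / _).
rewrite big_distrl [LHS]big_mkcond; apply: eq_bigr => e _ /=.
case: ifPn => [e_av|e_nav].
  have e_valid : valid (rcons s e) by rewrite valid_rcons e_av.
  rewrite IH // size_rcons subnS -card_available //.
  by congr (_ / _); apply: eq_big => [t|t _]; rewrite cat_rcons.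
rewrite big_pred0 ?mul0r // => t; rewrite -cat_rcons.
by apply: contraNF e_nav => /valid_catl; rewrite valid_rcons => /andP[].
Qed.

Lemma expect_le k s F G : valid s ->
  (forall t, valid (s ++ t) -> size t = k -> F (s ++ t) <= G (s ++ t)) ->
  expect k s F <= expect k s G.
Proof.
move=> s_valid FG; rewrite !expect_uniform // ler_wpM2r ?invr_ge0 //.
by apply: ler_sum => t t_valid; rewrite FG ?size_tuple.
Qed.

Lemma eq_expect k s F G : valid s ->
  (forall t, valid (s ++ t) -> size t = k -> F (s ++ t) = G (s ++ t)) ->
  expect k s F = expect k s G.
Proof.
move=> s_valid FG.
by apply/le_anti/andP; split; apply: expect_le => // t tv tk; rewrite FG.
Qed.

Lemma expectD k s F G :
  expect k s (fun s' => F s' + G s') = expect k s F + expect k s G.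
Proof.
elim: k s => //= k IH s; rewrite -mulrDl -big_split.
by congr (_ / _); apply: eq_bigr => e _; rewrite IH.
Qed.

Lemma expectZ k s c F : expect k s (fun s' => c * F s') = c * expect k s F.
Proof.
elim: k s => //= k IH s; rewrite mulrA big_distrr.
by congr (_ / _); apply: eq_bigr => e _; rewrite IH.
Qed.

Lemma expect_sum k s (I : finType) (F : I -> history n -> R) :
  expect k s (fun s' => \sum_i F i s') = \sum_i expect k s (F i).
Proof.
elim: k s => //= k IH s; rewrite -big_distrl exchange_big.
by congr (_ / _); apply: eq_bigr => e _; rewrite IH.
Qed.

Lemma expect_cst k s (c : R) :
  valid s -> (size s + k <= 'C(n, 2))%N -> expect k s (fun=> c) = c.
Proof.
elim: k s => //= k IH s s_valid s_le.
have av_gt0 : (0 < #|available s|)%N by apply: card_available_gt0 => //; lia.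
rewrite (eq_bigr (fun=> c)) => [|e e_av].
  by rewrite sumr_const -[c *+ _]mulr_natr mulfK // pnatr_eq0 -lt0n.
by rewrite IH ?valid_rcons ?e_av // size_rcons addSnnS.
Qed.

Lemma expect_add j k s F :
  expect (j + k) s F = expect j s (fun s' => expect k s' F).
Proof.
by elim: j s => //= j IH s; congr (_ / _); apply: eq_bigr => e _; rewrite IH.
Qed.

Lemma pr_le k s A B : valid s ->
  (forall t, valid (s ++ t) -> size t = k -> A (s ++ t) -> B (s ++ t)) ->
  pr k s A <= pr k s B.
Proof.
move=> s_valid AB; apply: expect_le => // t tv tk; rewrite ler_nat.
by have := AB t tv tk; case: (A _) => // ->.
Qed.

Lemma pr_predT k s : valid s -> (size s + k <= 'C(n, 2))%N -> pr k s predT = 1.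
Proof. exact: expect_cst. Qed.

Lemma pr_or k s A B : valid s -> pr k s (predU A B) <= pr k s A + pr k s B.
Proof.
move=> s_valid; rewrite /pr -expectD; apply: expect_le => // t _ _ /=.
by rewrite -natrD ler_nat; case: (A _); case: (B _).
Qed.

Lemma pr_exists k s (I : finType) (A : I -> pred (history n)) : valid s ->
  pr k s (fun s' => [exists i, A i s']) <= \sum_i pr k s (A i).
Proof.
move=> s_valid; rewrite /pr -expect_sum; apply: expect_le => // t _ _.
case: existsP => [[i Ai]|_]; last by apply: sumr_ge0 => i _; rewrite ler0n.
by rewrite (bigD1 i) //= Ai lerDl sumr_ge0.
Qed.

Lemma pr_rev k A : pr k [::] (A \o rev) = pr k [::] A.
Proof.
have rev_tupleK : involutive (fun t : k.-tuple {set 'I_n} => [tuple of rev t]).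
  by move=> t; apply: val_inj; rewrite /= revK.
rewrite /pr !expect_uniform // [in RHS](reindex_inj (inv_inj rev_tupleK)).
by congr (_ / _); apply: eq_bigl => t; rewrite /= /valid all_rev rev_uniq.
Qed.

Lemma co_probE A : co_prob A = pr 'C(n, 2) [::] A.
Proof.
rewrite /pr expect_uniform // subn0 ffactnn big_distrl /co_prob /=.
rewrite big_mkcond [RHS]big_mkcond; apply: eq_bigr => s _; rewrite co_massE -/(valid s).
by case: (A s); case: (valid s); rewrite ?mul1r ?mul0r.
Qed.

Lemma pr_take j m A : (j <= m <= 'C(n, 2))%N ->
  pr m [::] (fun s => A (take j s)) = pr j [::] A.
Proof.
move=> /andP[jm m_le]; rewrite /pr -{1}(subnKC jm) expect_add.
apply: eq_expect => // s s_valid s_size.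
rewrite (@eq_expect _ _ _ (fun=> (A s)%:R)) ?expect_cst ?s_size ?subnKC //.
by move=> t _ _; rewrite -s_size take_size_cat.
Qed.

Definition drift phi s : R := \sum_(e in available s) (phi (rcons s e) - phi s).

Lemma expect_drift_le k s phi rho : valid s -> (size s + k <= 'C(n, 2))%N ->
    (forall s', 0 <= phi s') ->
    (forall t, valid (s ++ t) -> (size t < k)%N ->
      drift phi (s ++ t) <= rho * #|available (s ++ t)|%:R * phi (s ++ t)) ->
  expect k s phi <= expR (k%:R * rho) * phi s.
Proof.
move=> s_valid s_le phi_ge0.
elim: k s s_valid s_le => [|k IH] s s_valid s_le drift_le /=.
  by rewrite mul0r expR0 mul1r.
have av_gt0 : (0 < #|available s|)%N by apply: card_available_gt0 => //; lia.
rewrite ler_pdivrMr ?ltr0n //.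
apply: (@le_trans _ _ (\sum_(e in available s) expR (k%:R * rho) * phi (rcons s e))).
  apply: ler_sum => e e_av; apply: IH; rewrite ?valid_rcons ?e_av ?size_rcons ?addSnnS //.
  by move=> t; rewrite cat_rcons => t_valid t_lt; apply: drift_le.
rewrite -big_distrr /= -natr1 mulrDl mul1r expRD -!mulrA.
apply: ler_wpM2l; first exact: expR_ge0.
have := drift_le [::]; rewrite cats0 => /(_ s_valid isT).
rewrite /drift sumrB sumr_const -[phi s *+ _]mulr_natr lerBlDr => /le_trans; apply.
rewrite mulrAC -mulrA -[X in _ + X]mul1r -mulrDl addrC ler_wpM2r ?mulr_ge0 //.
exact: expR_ge1Dx.
Qed.

Lemma pr_drift_le k s A phi q rho : valid s -> (size s + k <= 'C(n, 2))%N ->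
    (forall s', 0 <= phi s') ->
    (forall t, valid (s ++ t) -> (size t < k)%N ->
      drift phi (s ++ t) <= rho * #|available (s ++ t)|%:R * phi (s ++ t)) ->
    (forall t, valid (s ++ t) -> size t = k -> A (s ++ t) -> q <= phi (s ++ t)) ->
  q * pr k s A <= expR (k%:R * rho) * phi s.
Proof.
move=> s_valid s_le phi_ge0 drift_le A_phi.
apply: le_trans (expect_drift_le s_valid s_le phi_ge0 drift_le).
rewrite /pr -expectZ; apply: expect_le => // t t_valid t_size.
by have := A_phi t t_valid t_size; case: (A _) => [/(_ isT)|_]; rewrite ?mulr1 ?mulr0.
Qed.

Lemma pr_growth_le k s A phi q r : valid s -> (size s + k < 'C(n, 2))%N ->
    0 <= r -> (forall s', 0 <= phi s') ->
    (forall t, valid (s ++ t) -> (size t < k)%N -> drift phi (s ++ t) <= r * phi (s ++ t)) ->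
    (forall t, valid (s ++ t) -> size t = k -> A (s ++ t) -> q <= phi (s ++ t)) ->
  q * pr k s A <= expR (k%:R * (r / ('C(n, 2) - (size s + k))%:R)) * phi s.
Proof.
move=> s_valid s_lt r_ge0 phi_ge0 drift_le A_phi.
apply: pr_drift_le => // [|t t_valid t_lt]; first exact: ltnW.
apply: le_trans (drift_le t t_valid t_lt) _; rewrite ler_wpM2r // mulrAC -mulrA.
rewrite ler_peMr // ler_pdivlMr ?ltr0n ?subn_gt0 // mul1r ler_nat.
by rewrite card_available // size_cat; lia.
Qed.

Lemma pr_decay_le k s A phi q r : valid s -> (size s + k <= 'C(n, 2))%N ->
    (0 < 'C(n, 2))%N -> 0 <= r -> (forall s', 0 <= phi s') ->
    (forall t, valid (s ++ t) -> (size t < k)%N ->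
      drift phi (s ++ t) <= - r * phi (s ++ t)) ->
    (forall t, valid (s ++ t) -> size t = k -> A (s ++ t) -> q <= phi (s ++ t)) ->
  q * pr k s A <= expR (- (k%:R * (r / 'C(n, 2)%:R))) * phi s.
Proof.
move=> s_valid s_le N_gt0 r_ge0 phi_ge0 drift_le A_phi; rewrite -mulrN.
apply: pr_drift_le => // t t_valid t_lt.
apply: le_trans (drift_le t t_valid t_lt) _; rewrite ler_wpM2r // mulNr lerN2 mulrAC -mulrA.
rewrite ler_piMr // ler_pdivrMr ?ltr0n // mul1r ler_nat.
by rewrite card_available // leq_subr.
Qed.

End Expectation.

(** * Spread of a secret *)

Section Spread.
Variable n : nat.
Implicit Types (s : history n) (e : {set 'I_n}) (a b c v x y : 'I_n).

Definition call_sources e a : {set 'I_n} := if a \in e then e else [set a].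

Lemma call_sources_sym e a b : (a \in call_sources e b) = (b \in call_sources e a).
Proof.
have [->//|ab] := eqVneq a b; rewrite /call_sources.
case: ifP => be; case: ifP => ae;
  by rewrite ?be ?ae ?in_set1 ?[b == a]eq_sym ?(negPf ab).
Qed.

Lemma make_callE (K : knowledge n) e a :
  make_call K e a = \bigcup_(c in call_sources e a) K c.
Proof. by rewrite ffunE /call_sources; case: ifP => _; rewrite ?big_set1. Qed.

Lemma foldl_make_callE (K : knowledge n) s a :
  foldl (@make_call n) K s a = \bigcup_(c in knowledge_after s a) K c.
Proof.
elim/last_ind: s a => [|s e IH] a; first by rewrite /= ffunE big_set1.
rewrite /knowledge_after !foldl_rcons !make_callE.
apply/setP => y; apply/bigcupP/bigcupP => [[c ce]|[d /bigcupP[c ce dc] yd]].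
  rewrite IH => /bigcupP[d dc yd]; exists d => //.
  by apply/bigcupP; exists c.
by exists c => //; rewrite IH; apply/bigcupP; exists d.
Qed.

Lemma mem_knowledge_after_rcons s e a b :
  (b \in knowledge_after (rcons s e) a) =
  [exists c in call_sources e a, b \in knowledge_after s c].
Proof.
rewrite /knowledge_after foldl_rcons make_callE.
by apply/bigcupP/exists_inP => -[c]; exists c.
Qed.

Lemma mem_knowledge_after_cons s e a b :
  (b \in knowledge_after (e :: s) a) =
  [exists c in knowledge_after s a, b \in call_sources e c].
Proof.
rewrite /knowledge_after /= foldl_make_callE.
have init_call c : make_call (init_knowledge n) e c = call_sources e c.
  rewrite make_callE; apply/setP => y; apply/bigcupP/idP => [[d de]|ye].
    by rewrite ffunE inE => /eqP->.
  by exists y => //; rewrite ffunE set11.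
by apply/bigcupP/exists_inP => -[c ca bc]; exists c => //; move: bc; rewrite init_call.
Qed.

Lemma mem_knowledge_after_rev s a b :
  (b \in knowledge_after (rev s) a) = (a \in knowledge_after s b).
Proof.
elim: s a b => [|e s IH] a b; first by rewrite /knowledge_after /= !ffunE !in_set1 eq_sym.
rewrite rev_cons mem_knowledge_after_rcons mem_knowledge_after_cons.
apply/exists_inP/exists_inP => -[c ca bc]; exists c.
- by rewrite -IH.
- by rewrite call_sources_sym.
- by rewrite call_sources_sym.
- by rewrite IH.
Qed.

Lemma knowledge_after_take t m s a : (t <= m)%N ->
  knowledge_after (take t s) a \subset knowledge_after (take m s) a.
Proof.
move=> tm; rewrite -(subnKC tm) takeD /knowledge_after foldl_cat.
exact: foldl_make_call_mono.
Qed.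

Definition spread a s : {set 'I_n} := [set y | a \in knowledge_after s y].

Lemma mem_spread a b s : (b \in spread a s) = (a \in knowledge_after s b).
Proof. by rewrite inE. Qed.

Lemma spread_rev a s : spread a (rev s) = knowledge_after s a.
Proof. by apply/setP => y; rewrite mem_spread mem_knowledge_after_rev. Qed.

Lemma spread_nil a : spread a [::] = [set a].
Proof. by apply/setP => y; rewrite !inE ffunE inE eq_sym. Qed.

Lemma spread_self a s : a \in spread a s.
Proof.
rewrite inE; apply: (subsetP (foldl_make_call_mono s (init_knowledge n) a)).
by rewrite ffunE set11.
Qed.

Lemma spread_neq0 a s : spread a s != set0.
Proof. by apply/set0Pn; exists a; apply: spread_self. Qed.

Lemma spread_rcons a s e : spread a (rcons s e) =
  if [disjoint e & spread a s] then spread a s else e :|: spread a s.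
Proof.
apply/setP => y; rewrite inE mem_knowledge_after_rcons /call_sources.
have [ye|ye] := boolP (y \in e).
  have -> : [exists c in e, a \in knowledge_after s c] = ~~ [disjoint e & spread a s].
    rewrite -setI_eq0; apply/exists_inP/set0Pn => -[x].
      by exists x; rewrite in_setI mem_spread; apply/andP.
    by rewrite in_setI mem_spread => /andP[]; exists x.
  by case: ifP => [e_dis|]; rewrite /= ?(disjointFr e_dis ye) // in_setU ye.
have -> : [exists c in [set y], a \in knowledge_after s c] = (y \in spread a s).
  by rewrite mem_spread; apply/exists_inP/idP => [[c /set1P->]|] //; exists y; rewrite ?set11.
by case: ifP; rewrite ?in_setU ?(negPf ye).
Qed.

Definition uncalled s : {set 'I_n} := [set v | all (fun e => v \notin e) s].

Lemma uncalled_nil : uncalled [::] = setT.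
Proof. by apply/setP => v; rewrite !inE. Qed.

Lemma uncalled_rcons s e : uncalled (rcons s e) = uncalled s :\: e.
Proof. by apply/setP => v; rewrite !inE all_rcons. Qed.

Lemma spread_uncalled u s : u \in uncalled s -> spread u s = [set u].
Proof.
elim/last_ind: s => [|s e IH]; first by rewrite spread_nil.
rewrite uncalled_rcons inE => /andP[ue /IH spread_u].
by rewrite spread_rcons spread_u disjoint_sym disjoints1 ue.
Qed.

Definition partners s v : {set 'I_n} := [set y | [set v; y] \in s].

Lemma partners_nil v : partners [::] v = set0.
Proof. by apply/setP => y; rewrite !inE. Qed.

Lemma partners_sub_rcons s e v : partners s v \subset partners (rcons s e) v.
Proof. by apply/subsetP => y; rewrite !inE mem_rcons inE => ->; rewrite orbT. Qed.

Lemma card_partners_rcons s e v : e \in pairs n ->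
  (#|partners (rcons s e) v| <= #|partners s v| + (v \in e))%N.
Proof.
rewrite inE => /eqP card_e.
have sub : partners (rcons s e) v \subset partners s v :|: (if v \in e then e :\ v else set0).
  apply/subsetP => y; rewrite !inE mem_rcons inE => /orP[/eqP vy|->//].
  rewrite -vy set21 !inE eqxx orbT andbT; apply/orP; right.
  by apply: contra_eq_neq card_e => yv; rewrite -vy yv cards2 eqxx.
apply: leq_trans (subset_leq_card sub) (leq_trans (leq_card_setU _ _) _).
rewrite leq_add2l; case: ifP => ve; last by rewrite cards0.
by have := cardsD1 v e; rewrite ve card_e add1n => -[<-].
Qed.

Lemma card_pairs_sub (A : {set 'I_n}) : #|[set e in pairs n | e \subset A]| = 'C(#|A|, 2).
Proof. by rewrite -cards_draws; apply: eq_card => e; rewrite !inE andbC. Qed.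

Variable R : realType.
Implicit Types (A X : {set 'I_n}).

Lemma sum_cross_pairs X (G : {set 'I_n} -> R) :
    (forall e, e \in pairs n -> (e \subset X) || [disjoint e & X] -> G e = 0) ->
  \sum_(e in pairs n) G e = \sum_(x in X) \sum_(y in ~: X) G [set x; y].
Proof.
move=> G_eq0; rewrite pair_big_dep /=.
pose P := [set p : 'I_n * 'I_n | (p.1 \in X) && (p.2 \in ~: X)].
pose pair (p : 'I_n * 'I_n) := [set p.1; p.2].
have pair_inj : {in P &, injective pair}.
  move=> [x y] [x' y']; rewrite !inE /= => /andP[xX yX] /andP[xX' yX'] /setP E.
  move: (E x) (E y); rewrite !inE !eqxx orbT /= => /esym/orP[/eqP->|/eqP xy'].
    by move=> /esym/orP[/eqP yx'|/eqP->//]; rewrite yx' xX' in yX.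
  by rewrite xy' (negPf yX') in xX.
transitivity (\sum_(e in pair @: P) G e); last first.
  by rewrite big_imset //=; apply: eq_bigl => p; rewrite !inE.
rewrite (bigID (mem (pair @: P))) /= [X in _ + X]big1 ?addr0.
  apply: eq_bigl => e; rewrite andb_idl // => /imsetP[[x y]].
  rewrite !inE /= => /andP[xX yX] ->; rewrite cards2.
  by have [xy|//] := eqVneq x y; rewrite xy (negPf yX) in xX.
move=> e /andP[e_pair e_nP]; apply: G_eq0 => //; apply: contraNT e_nP; rewrite negb_or.
case/andP=> /subsetPn[y ye yX]; rewrite -setI_eq0 => /set0Pn[x /setIP[xe xX]].
apply/imsetP; exists (x, y); first by rewrite !inE xX yX.
apply/esym/eqP; rewrite eqEcard /pair /=; move: e_pair; rewrite inE => /eqP->.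
rewrite subUset !sub1set xe ye cards2.
by have [xy|//] := eqVneq x y; rewrite xy (negPf yX) in xX.
Qed.

Lemma sum_pairs_cardI X (h : nat -> R) : h 0%N = 0 ->
  \sum_(e in pairs n) h #|e :&: X| =
  'C(#|X|, 2)%:R * h 2%N + #|X|%:R * (n - #|X|)%:R * h 1%N.
Proof.
move=> h_0; rewrite (bigID (fun e : {set 'I_n} => e \subset X)) /=; congr (_ + _).
  rewrite (eq_bigr (fun=> h 2%N)) => [|e /andP[+ /setIidPl->]]; last by rewrite inE => /eqP->.
  rewrite (eq_bigl (mem [set e in pairs n | e \subset X])) => [|e]; last by rewrite [RHS]in_set.
  by rewrite sumr_const card_pairs_sub mulr_natl.
rewrite big_mkcondr (sum_cross_pairs (X := X)) => [|e _ /orP[->//|]]; last first.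
  by rewrite -setI_eq0 => /eqP->; rewrite cards0 h_0 if_same.
transitivity (\sum_(x in X) \sum_(y in ~: X) h 1%N).
  apply: eq_bigr => x xX; apply: eq_bigr => y; rewrite in_setC => yX.
  rewrite subUset !sub1set xX (negPf yX) (_ : _ :&: X = [set x]) ?cards1 //.
  apply/setP => z; rewrite !inE; have [->|zx] := eqVneq z x; first by rewrite xX.
  by have [->|//] := eqVneq z y; rewrite (negPf yX).
rewrite !sumr_const -mulrnA mulnC -natrM mulr_natl; congr (_ *+ (_ * _)).
by rewrite cardsCs setCK card_ord.
Qed.

Lemma drift_le_cardI (phi : history n -> R) s X (h : nat -> R) :
    h 0%N = 0 -> (forall j, 0 <= h j) ->
    (forall e, e \in pairs n -> phi (rcons s e) - phi s <= h #|e :&: X|) ->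
  drift phi s <= 'C(#|X|, 2)%:R * h 2%N + #|X|%:R * (n - #|X|)%:R * h 1%N.
Proof.
move=> h_0 h_ge0 phi_h; rewrite -sum_pairs_cardI // /drift.
under eq_bigl do rewrite inE.
by rewrite big_mkcondr; apply: ler_sum => e e_pair; case: ifP => _; rewrite ?phi_h.
Qed.

Lemma drift_spread a s (Phi : {set 'I_n} -> R) :
  drift (fun s => Phi (spread a s)) s =
  \sum_(x in spread a s) \sum_(y in ~: spread a s)
    ([set x; y] \notin s)%:R * (Phi (y |: spread a s) - Phi (spread a s)).
Proof.
rewrite /drift; under eq_bigl do rewrite inE.
transitivity (\sum_(e in pairs n)
    (e \notin s)%:R * (Phi (spread a (rcons s e)) - Phi (spread a s))).
  by rewrite big_mkcondr; apply: eq_bigr => e _; case: ifP => _; rewrite ?mul1r ?mul0r.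
rewrite (sum_cross_pairs (X := spread a s)).
  apply: eq_bigr => x xX; apply: eq_bigr => y _; congr (_ * (Phi _ - _)).
  rewrite spread_rcons -setI_eq0; case: ifPn => [/eqP/setP/(_ x)|_].
    by rewrite in_set0 in_setI set21 xX.
  by rewrite -setUA [RHS]/=; apply/setUidPr; rewrite sub1set in_setU xX orbT.
move=> e _; rewrite spread_rcons; case: ifP => [_ _|_ /orP[/setUidPr->|//]].
  by rewrite subrr mulr0.
by rewrite subrr mulr0.
Qed.

End Spread.

(** * Bounds for a fixed number of agents *)

Lemma natr_bin2 (R : realFieldType) (n : nat) :
  'C(n, 2)%:R = n%:R * (n%:R - 1) / 2 :> R.
Proof.
case: n => [|n]; first by rewrite !mul0r.
have /(congr1 (fun k => k%:R : R)) := mul_bin_diag n.+1 1.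
by rewrite bin1 /= !natrM -natr1; lra.
Qed.

Section FiniteBounds.
Variables (n : nat) (R : realType).
Implicit Types (s : history n) (X : {set 'I_n}) (a b u v x y : 'I_n) (eps : R).

Definition informed_potential eps b X : R := eps * n%:R * (b \in X)%:R + #|X|%:R.

Lemma informed_potential_ge0 eps b X : 0 < eps -> 0 <= informed_potential eps b X.
Proof. by move=> eps_gt0; rewrite addr_ge0 // !mulr_ge0 // ltW. Qed.

Lemma drift_informed_potential eps a b s : 0 < eps ->
  drift (fun s' => informed_potential eps b (spread a s')) s
  <= (1 + eps) * n%:R * informed_potential eps b (spread a s).
Proof.
move=> eps_gt0; rewrite drift_spread; set X := spread a s.
have epsn_ge0 : 0 <= eps * n%:R by rewrite mulr_ge0 // ltW.
have gain_sum : \sum_(y : 'I_n) (1 + eps * n%:R * (y == b)%:R) = (1 + eps) * n%:R.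
  rewrite big_split /= sumr_const card_ord (bigD1 b) //= eqxx big1 => [|y /negPf->].
    by rewrite mulr1 addr0 mulrDl mul1r.
  by rewrite mulr0.
apply: (@le_trans _ _ (\sum_(x in X) (1 + eps) * n%:R)); last first.
  rewrite sumr_const -[leLHS]mulr_natr ler_wpM2l //; last by rewrite lerDr mulr_ge0.
  by rewrite mulr_ge0 // addr_ge0 // ltW.
have gain_ge0 y : 0 <= 1 + eps * n%:R * (y == b)%:R by rewrite addr_ge0 // mulr_ge0.
apply: ler_sum => x _; rewrite -gain_sum [leRHS](bigID (mem (~: X))) /= ler_wpDr ?sumr_ge0 //.
apply: ler_sum => y; rewrite in_setC => yX.
apply: (@le_trans _ _ (informed_potential eps b (y |: X) - informed_potential eps b X)).
  rewrite ler_piMl ?lern1 ?leq_b1 // subr_ge0 lerD ?ler_nat ?subset_leq_card ?subsetU1 //.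
  by rewrite ler_wpM2l // ler_nat in_setU1; case: (b \in X); rewrite ?orbT.
rewrite /informed_potential cardsU1 yX in_setU1 natrD (eq_sym b y).
by have [<-|_] := eqVneq y b; rewrite ?(negPf yX) /=; lra.
Qed.

Lemma pr_informed a b m eps : 0 < eps -> a != b -> (m < 'C(n, 2))%N ->
  eps * n%:R * pr R m [::] (fun s => b \in spread a s)
  <= expR (m%:R * ((1 + eps) * n%:R / ('C(n, 2) - m)%:R)).
Proof.
move=> eps_gt0 ab m_lt; pose phi s := informed_potential eps b (spread a s).
have phi_nil : phi [::] = 1.
  rewrite /phi /informed_potential spread_nil in_set1 eq_sym (negPf ab) mulr0 add0r.
  by rewrite cards1.
rewrite -[leRHS]mulr1 -[X in _ <= _ * X]phi_nil.
apply: pr_growth_le => // [|s|s _ _|s _ _ /= b_in].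
- by rewrite mulr_ge0 // addr_ge0 // ltW.
- exact: informed_potential_ge0.
- exact: drift_informed_potential.
- by rewrite /phi /informed_potential b_in mulr1 lerDl.
Qed.

Lemma drift_inv_uncalled s :
  drift (fun s' => #|uncalled s'|.+1%:R^-1) s <= n%:R * #|uncalled s|.+1%:R^-1 :> R.
Proof.
pose i := #|uncalled s|; pose gain j : R := (i - j).+1%:R^-1 - i.+1%:R^-1.
apply: le_trans (drift_le_cardI (X := uncalled s) (h := gain) _ _ _) _.
- by rewrite /gain subn0 subrr.
- by move=> j; rewrite subr_ge0 lef_pV2 ?posrE // ler_nat ltnS leq_subr.
- by move=> e _; rewrite uncalled_rcons cardsD setIC.
rewrite /gain -/i natr_bin2.
have : (i <= n)%N by rewrite -[leqRHS]card_ord max_card.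
case: i {gain} => [|[|i]] i_le; rewrite ?subSS ?subn0 ?natrB //.
- by rewrite !mul0r add0r divr_ge0.
- by rewrite subrr mulr0 !mul0r invr1; lra.
have i_ge0 : 0 <= i%:R :> R by [].
rewrite le_eqVlt; apply/orP; left; apply/eqP; rewrite -!natr1; field.
by do ?[apply/andP; split]; apply: lt0r_neq0; lra.
Qed.

Lemma pr_no_uncalled m : (m < 'C(n, 2))%N ->
  pr R m [::] (fun s => uncalled s == set0)
  <= expR (m%:R * (n%:R / ('C(n, 2) - m)%:R)) / n%:R.
Proof.
move=> m_lt; have n_gt0 : (0 < n)%N by case: n m_lt.
pose phi s : R := #|uncalled s|.+1%:R^-1.
apply: (@le_trans _ _ (expR (m%:R * (n%:R / ('C(n, 2) - m)%:R)) * phi [::])); last first.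
  rewrite ler_wpM2l ?expR_ge0 // /phi uncalled_nil cardsT card_ord.
  by rewrite lef_pV2 ?posrE ?ltr0n // ler_nat.
rewrite -[leLHS]mul1r; apply: pr_growth_le => // [s|s _ _|s _ _ /= /eqP no_uncalled].
- by rewrite invr_ge0.
- exact: drift_inv_uncalled.
- by rewrite /phi no_uncalled cards0 invr1.
Qed.

Lemma drift_exp2_partners v s :
  drift (fun s' => 2 ^+ #|partners s' v|) s <= n%:R * 2 ^+ #|partners s v| :> R.
Proof.
pose gain j : R := j%:R * 2 ^+ #|partners s v|.
apply: le_trans (drift_le_cardI (X := [set v]) (h := gain) _ _ _) _.
- by rewrite /gain mul0r.
- by move=> j; rewrite mulr_ge0 ?exprn_ge0.
- move=> e e_pair; have -> : #|e :&: [set v]| = (v \in e).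
    have [ve|ve] := boolP (v \in e); first by rewrite (setIidPr _) ?cards1 ?sub1set.
    by apply/eqP; rewrite cards_eq0 setI_eq0 disjoint_sym disjoints1.
  rewrite /gain lerBlDr; apply: (@le_trans _ _ (2 ^+ (#|partners s v| + (v \in e)))).
    by rewrite ler_weXn2l ?ler1n // card_partners_rcons.
  by rewrite exprD; case: (v \in e); rewrite /= ?expr1 ?expr0; lra.
rewrite cards1 bin_small // mul0r add0r /gain !mul1r ler_wpM2r ?exprn_ge0 //.
by rewrite ler_nat leq_subr.
Qed.

Lemma pr_degree v D m : (m < 'C(n, 2))%N ->
  2 ^+ D * pr R m [::] (fun s => D <= #|partners s v|)%N
  <= expR (m%:R * (n%:R / ('C(n, 2) - m)%:R)).
Proof.
move=> m_lt; pose phi s : R := 2 ^+ #|partners s v|.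
have phi_nil : phi [::] = 1 by rewrite /phi partners_nil cards0.
rewrite -[leRHS]mulr1 -[X in _ <= _ * X]phi_nil.
apply: pr_growth_le => // [s|s _ _|s _ _ /= D_le].
- by rewrite exprn_ge0.
- exact: drift_exp2_partners.
- by rewrite ler_weXn2l // ler1n.
Qed.

Definition low_degree D s := [forall v, #|partners s v| <= D]%N.

Lemma pr_high_degree D m : (m < 'C(n, 2))%N ->
  2 ^+ D * pr R m [::] (fun s => ~~ low_degree D s)
  <= n%:R * expR (m%:R * (n%:R / ('C(n, 2) - m)%:R)).
Proof.
move=> m_lt.
have high_sub : pr R m [::] (fun s => ~~ low_degree D s)
    <= pr R m [::] (fun s => [exists v, D <= #|partners s v|]%N).
  apply: pr_le => // s _ _; rewrite negb_forall => /existsP[v v_high].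
  by apply/existsP; exists v; rewrite ltnW // ltnNge.
apply: (@le_trans _ _ (\sum_v 2 ^+ D * pr R m [::] (fun s => D <= #|partners s v|)%N)).
  by rewrite -big_distrr ler_wpM2l // (le_trans high_sub) //; apply: pr_exists.
set growth := expR _; have -> : n%:R * growth = \sum_(v : 'I_n) growth.
  by rewrite sumr_const card_ord mulr_natl.
by apply: ler_sum => v _; apply: pr_degree.
Qed.

(* Chosen for [full_potential_diff]: [x * (n - x)] calls turn a spread of [x] agents into
   one of [x + 1], so that the rate of growth does not depend on [x]. *)
Definition full_potential (k x : nat) : R :=
  \prod_(i < k) ((x + i)%:R / (n - x + i).+1%:R).

Lemma full_potential_ge0 (k x : nat) : 0 <= full_potential k x.
Proof. by apply: prodr_ge0 => i _; rewrite divr_ge0. Qed.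

Lemma full_potentialS (k x : nat) : (x < n)%N ->
  full_potential k x.+1 * (x%:R * (n - x)%:R) =
  full_potential k x * ((x + k)%:R * (n - x + k)%:R).
Proof.
move=> x_lt; elim: k => [|k IH]; first by rewrite /full_potential !big_ord0 !addn0.
rewrite /full_potential !big_ord_recr /= -!/(full_potential _ _).
have -> : ((n - x.+1 + k).+1 = n - x + k)%N by lia.
have p_neq0 : (n - x + k)%:R != 0 :> R by rewrite pnatr_eq0; lia.
have pS_neq0 : (n - x + k).+1%:R != 0 :> R by rewrite pnatr_eq0.
rewrite mulrAC IH !addnS !addSn.
move: p_neq0 pS_neq0; move: (n - x + k)%:R (n - x + k).+1%:R => p pS p_neq0 pS_neq0.
by field; rewrite p_neq0 pS_neq0.
Qed.

Lemma full_potential_diff (k x : nat) : (x < n)%N ->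
  x%:R * (n - x)%:R * (full_potential k x.+1 - full_potential k x) =
  k%:R * (n + k)%:R * full_potential k x.
Proof.
move=> x_lt; rewrite mulrBr [_ * full_potential k x.+1]mulrC full_potentialS //.
by rewrite !natrD natrB 1?ltnW //; ring.
Qed.

Lemma full_potential_leS (k x : nat) : (0 < x < n)%N ->
  full_potential k x <= full_potential k x.+1.
Proof.
move=> /andP[x_gt0 x_lt]; rewrite -subr_ge0 -(@pmulr_rge0 _ (x%:R * (n - x)%:R)).
  by rewrite full_potential_diff // !mulr_ge0 // full_potential_ge0.
by rewrite mulr_gt0 // ltr0n ?subn_gt0.
Qed.

Lemma full_potential1_le k : (0 < n)%N -> full_potential k 1 <= (k%:R / n%:R) ^+ k.
Proof.
move=> n_gt0; rewrite -[k in X in _ <= _ ^+ X]card_ord -prodr_const.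
apply: ler_prod => i _; rewrite divr_ge0 //=.
rewrite ler_pdivrMr ?ltr0n // mulrAC ler_pdivlMr ?ltr0n // -!natrM ler_nat.
by have := ltn_ord i; nia.
Qed.

Lemma full_potentialn k : (0 < n)%N -> full_potential k n * full_potential k 1 = 1.
Proof.
move=> n_gt0; rewrite /full_potential -big_split big1 // => i _ /=.
rewrite subnn add0n add1n (_ : (n - 1 + i).+1 = n + i)%N; last by lia.
by rewrite -[X in _ * X]invf_div divff // mulf_neq0 // ?invr_eq0 pnatr_eq0; lia.
Qed.

Lemma drift_full_potential u k s :
  drift (fun s' => full_potential k #|spread u s'|) s
  <= k%:R * (n + k)%:R * full_potential k #|spread u s|.
Proof.
rewrite (drift_spread u s (fun X => full_potential k #|X|)); set X := spread u s.
have X_gt0 : (0 < #|X|)%N by rewrite card_gt0 spread_neq0.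
have [X_lt|X_ge] := ltnP #|X| n; last first.
  have X_full : ~: X = set0.
    by apply/eqP; rewrite -cards_eq0 cardsCs setCK card_ord subn_eq0.
  rewrite X_full big1 => [|x _]; last by rewrite big_set0.
  by rewrite !mulr_ge0 // full_potential_ge0.
rewrite -full_potential_diff //.
apply: (@le_trans _ _ (\sum_(x in X) \sum_(y in ~: X)
    (full_potential k #|X|.+1 - full_potential k #|X|))).
  apply: ler_sum => x _; apply: ler_sum => y; rewrite in_setC cardsU1 => ->.
  by rewrite add1n ler_piMl ?lern1 ?leq_b1 // subr_ge0 full_potential_leS // X_gt0.
by rewrite !sumr_const -mulrnA [#|~: X|]cardsCs setCK card_ord -natrM mulr_natl mulnC.
Qed.

Lemma pr_spread_full u k s j : valid s -> u \in uncalled s -> (size s + j < 'C(n, 2))%N ->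
  pr R j s (fun s' => spread u s' == setT)
  <= (k%:R / n%:R) ^+ k ^+ 2
     * expR (j%:R * (k%:R * (n + k)%:R / ('C(n, 2) - (size s + j))%:R)).
Proof.
move=> s_valid u_uncalled s_lt; have n_gt0 : (0 < n)%N by apply: leq_ltn_trans (ltn_ord u).
set growth := expR _.
have pot1_gt0 : 0 < full_potential k 1.
  rewrite lt_def full_potential_ge0 andbT; apply/eqP => pot1_eq0.
  by have := full_potentialn k n_gt0; rewrite pot1_eq0 mulr0 => /esym/eqP; rewrite oner_eq0.
have pot_bound : full_potential k n * pr R j s (fun s' => spread u s' == setT)
    <= growth * full_potential k 1.
  rewrite -[X in _ * full_potential k X](cards1 u) -(spread_uncalled u_uncalled).
  apply: (pr_growth_le (phi := fun s' => full_potential k #|spread u s'|)) => //.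
  - by move=> s'; exact: full_potential_ge0.
  - by move=> t _ _; exact: drift_full_potential.
  - by move=> t _ _ /eqP->; rewrite cardsT card_ord.
have -> : pr R j s (fun s' => spread u s' == setT) =
    full_potential k 1 * (full_potential k n * pr R j s (fun s' => spread u s' == setT)).
  by rewrite mulrA [_ * full_potential k n]mulrC full_potentialn // mul1r.
apply: le_trans (ler_wpM2l (ltW pot1_gt0) pot_bound) _.
rewrite mulrCA -expr2 mulrC ler_wpM2r ?expR_ge0 //.
by rewrite lerXn2r ?nnegrE ?full_potential_ge0 ?full_potential1_le // exprn_ge0 // divr_ge0.
Qed.

Lemma pr_all_experts_le j k (p : R) : 0 <= p -> (j + k <= 'C(n, 2))%N ->
    (forall s u, valid s -> size s = j -> u \in uncalled s ->
      pr R k s (fun s' => spread u s' == setT) <= p) ->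
  pr R (j + k) [::] (fun s => @all_experts n (knowledge_after s))
  <= pr R j [::] (fun s => uncalled s == set0 :> {set 'I_n}) + p.
Proof.
move=> p_ge0 jk_le full_le; rewrite {1}/pr expect_add.
rewrite -[X in _ + X](@expect_cst n R j [::]) ?(leq_trans (leq_addr _ _) jk_le) //.
rewrite -expectD; apply: expect_le => // s s_valid s_size /=.
have s_le : (size s + k <= 'C(n, 2))%N by rewrite s_size.
have [_|/set0Pn[u u_uncalled]] := eqVneq.
  apply: (@le_trans _ _ (pr R k s predT)); first exact: pr_le.
  by rewrite pr_predT // lerDl.
rewrite add0r; apply: le_trans (full_le s u s_valid s_size u_uncalled).
apply: pr_le => // t _ _ /forallP all_t; rewrite -subTset; apply/subsetP => y _.
by rewrite mem_spread (eqP (all_t y)) in_setT.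
Qed.

Definition uninformed_weight (eps : R) (x : nat) : R :=
  if (x <= 1)%N then eps^-1 else x.-1%:R^-1.

Lemma uninformed_weight_gt0 eps (x : nat) : 0 < eps -> 0 < uninformed_weight eps x.
Proof.
by move=> eps_gt0; rewrite /uninformed_weight; case: leqP; rewrite invr_gt0 // ltr0n; lia.
Qed.

Lemma uninformed_weightS eps (x : nat) : 0 < eps -> eps < 1 -> (0 < x)%N ->
  uninformed_weight eps x.+1 - uninformed_weight eps x
  <= - ((1 - eps) * uninformed_weight eps x / x%:R).
Proof.
move=> eps_gt0 eps_lt1; case: x => [//|[_|x _]]; rewrite /uninformed_weight /=.
  by rewrite le_eqVlt; apply/orP; left; apply/eqP; field; exact: lt0r_neq0.
have x_ge0 : 0 <= x%:R :> R by [].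
have -> : x.+2%:R^-1 - x.+1%:R^-1 = - (x.+1%:R^-1 / x.+2%:R) :> R.
  by rewrite -!natr1; field; apply/andP; split; apply: lt0r_neq0; lra.
by rewrite lerN2 -mulrA ler_piMl ?divr_ge0 ?invr_ge0 //; lra.
Qed.

Lemma sum_fresh_ge D s v (Y : {set 'I_n}) : low_degree D s ->
  #|Y|%:R - D%:R <= \sum_(y in Y) ([set v; y] \notin s)%:R :> R.
Proof.
move=> /forallP/(_ v) deg_v; rewrite lerBlDr -natr_sum -natrD ler_nat.
have -> : (\sum_(y in Y) ([set v; y] \notin s) = #|Y :\: partners s v|)%N.
  rewrite -sum1_card big_mkcond [RHS]big_mkcond; apply: eq_bigr => y _; rewrite !inE.
  by case: (y \in Y); case: (_ \in s).
rewrite -(cardsID (partners s v) Y) addnC leq_add2l.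
exact: leq_trans (subset_leq_card (subsetIr _ _)) deg_v.
Qed.

Lemma sum_fresh_cross_ge D s b X : low_degree D s -> X != set0 -> b \notin X ->
  n%:R - 1 - 2 * D%:R <=
  \sum_(x in X) \sum_(y in ~: X)
    ([set x; y] \notin s)%:R * (if y == b then 1 else #|X|%:R^-1) :> R.
Proof.
move=> low X_neq0 bX.
have X_gt0 : 0 < #|X|%:R :> R by rewrite ltr0n card_gt0.
pose fresh x y : R := ([set x; y] \notin s)%:R.
have split_b x : \sum_(y in ~: X) fresh x y * (if y == b then 1 else #|X|%:R^-1) =
    fresh b x + (\sum_(y in ~: X :\ b) fresh x y) / #|X|%:R.
  rewrite (big_setD1 b) ?in_setC //= eqxx mulr1 big_distrl /fresh setUC; congr (_ + _).
  by apply: eq_bigr => y /setD1P[/negPf->].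
rewrite (eq_bigr _ (fun x _ => split_b x)) big_split /= -big_distrl /=.
have card_rest : #|~: X :\ b|%:R = n%:R - 1 - #|X|%:R :> R.
  have := cardsC X; rewrite card_ord (cardsD1 b (~: X)) in_setC bX.
  by move=> /(congr1 (fun k => k%:R : R)) /=; rewrite !natrD /=; lra.
have rest_ge : #|X|%:R * (n%:R - 1 - #|X|%:R - D%:R)
    <= \sum_(x in X) \sum_(y in ~: X :\ b) fresh x y.
  rewrite mulr_natl -sumr_const -card_rest; apply: ler_sum => x _; exact: sum_fresh_ge.
have b_ge := sum_fresh_ge b X low.
rewrite -ler_pdivlMl // mulrC in rest_ge.
by apply: le_trans (lerD b_ge rest_ge); lra.
Qed.

Definition uninformed_potential eps b X : R :=
  (b \notin X)%:R * uninformed_weight eps #|X|.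

Lemma uninformed_potential_ge0 eps b X : 0 < eps -> 0 <= uninformed_potential eps b X.
Proof. by move=> eps_gt0; rewrite mulr_ge0 // ltW // uninformed_weight_gt0. Qed.

Lemma drift_uninformed_potential eps a b D s : 0 < eps -> eps < 1 -> low_degree D s ->
  drift (fun s' => uninformed_potential eps b (spread a s')) s
  <= - ((1 - eps) * (n%:R - 1 - 2 * D%:R)) * uninformed_potential eps b (spread a s).
Proof.
move=> eps_gt0 eps_lt1 low; rewrite drift_spread; set X := spread a s.
have [bX|bX] := boolP (b \in X).
  rewrite {3}/uninformed_potential bX mul0r mulr0 big1 // => x _; rewrite big1 // => y _.
  by rewrite /uninformed_potential in_setU1 bX orbT !mul0r subrr mulr0.
have X_gt0 : (0 < #|X|)%N by rewrite card_gt0 spread_neq0.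
pose c := (1 - eps) * uninformed_potential eps b X.
have c_ge0 : 0 <= c by rewrite mulr_ge0 ?uninformed_potential_ge0 //; lra.
apply: (@le_trans _ _ (- c * (\sum_(x in X) \sum_(y in ~: X)
    ([set x; y] \notin s)%:R * (if y == b then 1 else #|X|%:R^-1)))); last first.
  rewrite !mulNr lerN2 mulrAC -/c ler_wpM2l // sum_fresh_cross_ge //.
  exact: spread_neq0.
rewrite big_distrr; apply: ler_sum => x _; rewrite big_distrr; apply: ler_sum => y /=.
rewrite in_setC mulrCA => yX; rewrite ler_wpM2l // /c /uninformed_potential.
rewrite in_setU1 negb_or (negPf bX) andbT mul1r (eq_sym b y) cardsU1 yX add1n.
have := uninformed_weight_gt0 #|X| eps_gt0; case: eqVneq => _ weight_gt0.
  by rewrite mul0r mulr1 sub0r lerN2 ler_piMl // ?ltW //; lra.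
by rewrite mul1r mulNr uninformed_weightS.
Qed.

Lemma pr_uninformed a b D m eps : 0 < eps -> eps < 1 -> (m < 'C(n, 2))%N -> (D.*2 < n)%N ->
  pr R m [::] (fun s => low_degree D s && (b \notin spread a s))
  <= n%:R / eps
     * expR (- (m%:R * ((1 - eps) * (n%:R - 1 - 2 * D%:R) / 'C(n, 2)%:R))).
Proof.
move=> eps_gt0 eps_lt1 m_lt D_lt.
have n_gt1 : (1 < n)%N by move: m_lt; case: (n) => [|[|]].
have n_gt0 : 0 < n%:R :> R by rewrite ltr0n ltnW.
pose phi s : R := (low_degree D s)%:R * uninformed_potential eps b (spread a s).
have phi_ge0 s : 0 <= phi s by rewrite mulr_ge0 ?uninformed_potential_ge0.
have phi_nil : phi [::] <= eps^-1.
  rewrite /phi /uninformed_potential spread_nil cards1 /uninformed_weight mulrA ler_piMl //.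
    by rewrite invr_ge0 ltW.
  by rewrite -natrM lern1 mulnb leq_b1.
set rate := (1 - eps) * _; set decay := expR _.
have rate_ge0 : 0 <= rate.
  apply: mulr_ge0; first by rewrite subr_ge0 ltW.
  by rewrite subr_ge0 lerBrDr -natrM natr1 ler_nat mul2n.
rewrite -mulrA -ler_pdivrMl // [leRHS]mulrC.
apply: (@le_trans _ _ (decay * phi [::])); last by rewrite ler_wpM2l ?expR_ge0.
apply: (pr_decay_le (phi := phi) (r := rate)) => // [||s _ _|s _ _ /= /andP[low b_out]].
- exact: ltnW.
- by rewrite bin_gt0.
- have [low|high] := boolP (low_degree D s); last first.
    rewrite /phi (negPf high) mul0r mulr0 /drift big1 // => e _.
    suff /negPf-> : ~~ low_degree D (rcons s e) by rewrite (negPf high) !mul0r subrr.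
    apply: contraNN high => /forallP low; apply/forallP => v.
    exact: leq_trans (subset_leq_card (partners_sub_rcons _ _ _)) (low v).
  rewrite {2}/phi low mul1r.
  apply: le_trans (drift_uninformed_potential a b eps_gt0 eps_lt1 low).
  apply: ler_sum => e _; rewrite /phi low mul1r lerD2r ler_piMl ?lern1 ?leq_b1 //.
  exact: uninformed_potential_ge0.
rewrite /phi low /uninformed_potential b_out !mul1r /uninformed_weight.
have spread_le : (#|spread a s| <= n)%N by rewrite -[leqRHS]card_ord max_card.
case: leqP => [_|spread_gt1]; rewrite lef_pV2 ?posrE // ?ler_nat ?ltr0n; try lia.
by rewrite (le_trans (ltW eps_lt1)) // ler1n ltnW.
Qed.

End FiniteBounds.

(** * The number of calls until a property holds *)

Section CallsUntil.
Variable n : nat.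
Implicit Types (Q : pred (knowledge n)) (s : history n).

Definition upward Q := forall K K' : knowledge n, (forall a, K a \subset K' a) -> Q K -> Q K'.

Lemma upward_exchanged a b : upward (exchanged a b).
Proof. by move=> K K' KK' /andP[/(subsetP (KK' a)) ? /(subsetP (KK' b)) ?]; apply/andP. Qed.

Lemma upward_expert a : upward (expert a).
Proof. by move=> K K' KK' /eqP Ka; rewrite /expert -subTset -Ka. Qed.

Lemma upward_some_expert : upward (@some_expert n).
Proof. by move=> K K' KK' /existsP[a /(upward_expert KK') ?]; apply/existsP; exists a. Qed.

Lemma upward_all_experts : upward (@all_experts n).
Proof.
by move=> K K' KK' /forallP all_K; apply/forallP => a; apply: upward_expert (all_K a).
Qed.

Lemma ltn_calls_until Q s m : upward Q -> (m <= size s)%N ->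
  (m < calls_until Q s)%N = ~~ Q (knowledge_after (take m s)).
Proof.
move=> upQ m_le; apply/idP/idP => [/(before_find 0%N)|]; first by rewrite nth_iota // => ->.
apply: contraR; rewrite -leqNgt => le_m.
have lt_s : (calls_until Q s < (size s).+1)%N by rewrite ltnS (leq_trans le_m).
have := lt_s; rewrite -[ltnRHS](size_iota 0) -has_find => /(nth_find 0%N).
rewrite -/(calls_until Q s) nth_iota // add0n; apply: upQ => a.
exact: knowledge_after_take.
Qed.

Lemma co_prob_le1 (R : realType) (A : pred (history n)) :
  co_prob (fun s : co_seq n => A s) <= 1 :> R.
Proof. by rewrite co_probE -(@pr_predT n R 'C(n, 2) [::]) // pr_le. Qed.

Lemma co_prob_calls_until_ge (R : realType) Q (P : pred nat) i j : upward Q ->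
    (i <= 'C(n, 2))%N -> (j <= 'C(n, 2))%N -> (forall t, (i < t <= j)%N -> P t) ->
  1 - pr R i [::] (fun s => Q (knowledge_after s))
    - pr R j [::] (fun s => ~~ Q (knowledge_after s))
  <= co_prob (fun s : co_seq n => P (calls_until Q s)).
Proof.
move=> upQ i_le j_le P_between; rewrite !lerBlDr (co_probE R (fun s => P (calls_until Q s))).
rewrite -(@pr_take n R i 'C(n, 2)) ?i_le ?leqnn // -(@pr_take n R j 'C(n, 2)) ?j_le ?leqnn //.
apply: le_trans (lerD (pr_or _ _ _ _ _) (lexx _)) => //.
apply: le_trans (pr_or _ _ _ _ _) => //.
rewrite -(@pr_predT n R 'C(n, 2) [::]) //; apply: pr_le => // s _ /= s_size _.
apply/orP; have [Qi|nQi] := boolP (Q (knowledge_after (take i s))); first by right.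
left; rewrite -ltn_calls_until ?s_size // orbC -implyNb -leqNgt; apply/implyP => le_j.
by apply: P_between; rewrite le_j andbT ltn_calls_until ?s_size.
Qed.

End CallsUntil.

(** * Asymptotics *)

Section Asymptotics.
Variable R : realType.
Implicit Types (c C eps eta : R) (A B : forall n, pred (history n.+2)).

Local Notation log n := (ln (n%:R : R)).

Definition nlogn (n : nat) : R := n%:R * log n.

Lemma ln_natr_ge0 (n : nat) : 0 <= log n.
Proof. by case: n => [|n]; [rewrite ln0 | rewrite ln_ge0 // ler1n]. Qed.

Lemma nlogn_ge0 n : 0 <= nlogn n.
Proof. by rewrite mulr_ge0 // ln_natr_ge0. Qed.

Lemma powR_natr (n : nat) (x : R) : (0 < n)%N -> n%:R `^ x = expR (x * log n).
Proof. by move=> n_gt0; rewrite /powR pnatr_eq0 gtn_eqF. Qed.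

Lemma near_ln_ge (x : R) : \forall n \near \oo, x <= log n.
Proof.
apply: filterS (nbhs_infty_ger (expR x)) => n n_ge.
by rewrite -ler_expR lnK // posrE (lt_le_trans (expR_gt0 x)).
Qed.

Lemma near_nlogn_ge (x : R) : \forall n \near \oo, x <= nlogn n.
Proof.
apply: filterS2 (nbhs_infty_ger x) (near_ln_ge 1) => n n_ge ln_ge.
by rewrite (le_trans n_ge) // ler_peMr.
Qed.

Lemma near_ln_le eps : 0 < eps -> \forall n \near \oo, log n <= eps * n%:R.
Proof.
move=> eps_gt0; apply: filterS2 (nbhs_infty_ge 1) (near_ln_ge (2 / eps)) => n n_gt0 ln_ge.
have ln_gt0 : 0 < log n by apply: lt_le_trans ln_ge; rewrite divr_gt0.
have := expR_ge1Dxn 1 (ltW ln_gt0); rewrite lnK ?posrE ?ltr0n // => sq_le.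
have {}sq_le : log n * log n <= 2 * n%:R.
  by move: sq_le; rewrite expr2 (_ : 2`!%N = 2%N) //; lra.
rewrite mulrC -ler_pdivrMr //.
have : log n * (2 / eps) <= log n * log n by rewrite ler_pM2l.
by move: sq_le; rewrite mulrCA; lra.
Qed.

Lemma near_powRN_le c (K : R) eta : 0 < c -> 0 < eta ->
  \forall n \near \oo, K * n%:R `^ (- c) <= eta.
Proof.
move=> c_gt0 eta_gt0.
apply: filterS2 (nbhs_infty_ge 1) (near_ln_ge (K / (eta * c))) => n n_gt0.
rewrite ler_pdivrMr ?mulr_gt0 // powR_natr // mulNr expRN => K_le.
rewrite ler_pdivrMr ?expR_gt0 //; apply: le_trans K_le _.
by rewrite mulrC -mulrA ler_pM2l // (le_trans _ (expR_ge1Dx _)) // lerDr.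
Qed.

Lemma near_pairs_left eps (C : R) : 0 < eps -> eps < 1 ->
  \forall n \near \oo, forall m, m%:R <= C * nlogn n ->
    (m < 'C(n, 2))%N /\ (1 - eps) * n%:R ^+ 2 / 2 <= ('C(n, 2) - m)%:R.
Proof.
move=> eps_gt0 eps_lt1; have norm_gt0 : 0 < `|C| + 1 by rewrite ltr_wpDl.
have slope_gt0 : 0 < eps / 4 / (`|C| + 1) by rewrite !divr_gt0.
apply: filterS2 (near_ln_le slope_gt0) (nbhs_infty_ger (2 / eps)) => n ln_le n_ge m m_le.
have n_gt0 : 0 < n%:R :> R by apply: lt_le_trans n_ge; rewrite divr_gt0.
have {}n_ge : 2 <= eps * n%:R by rewrite mulrC -ler_pdivrMr.
have {}ln_le : (`|C| + 1) * log n <= eps / 4 * n%:R.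
  by rewrite mulrC -ler_pdivlMr // mulrAC.
have {}m_le : m%:R <= n%:R * (eps / 4 * n%:R).
  apply: le_trans m_le (le_trans _ (ler_wpM2l (ltW n_gt0) ln_le)).
  rewrite mulrCA ler_wpM2l // ler_wpM2r ?ln_natr_ge0 //.
  by rewrite (le_trans (ler_norm C)) // lerDl.
have left_ge : (1 - eps) * n%:R ^+ 2 / 2 <= 'C(n, 2)%:R - m%:R.
  by rewrite natr_bin2; have := ler_wpM2l (ltW n_gt0) n_ge; nra.
have m_lt : (m < 'C(n, 2))%N.
  rewrite -(ltr_nat R) -subr_gt0; apply: lt_le_trans left_ge.
  by rewrite !mulr_gt0 ?exprn_gt0 // ?subr_gt0 // invr_gt0.
by rewrite natrB // ltnW.
Qed.

Lemma near_ltn_bin2 C : \forall n \near \oo, forall m, m%:R <= C * nlogn n -> (m < 'C(n, 2))%N.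
Proof.
have [half_gt0 half_lt1] : 0 < 2^-1 :> R /\ 2^-1 < 1 :> R by split; lra.
by apply: filterS (near_pairs_left C half_gt0 half_lt1) => n left_ge m /left_ge[].
Qed.

Lemma near_powR_le_exp2 (p : R) eps : 0 < eps ->
  \forall n \near \oo, n%:R `^ p <= 2 ^+ Num.truncn (eps * n%:R).
Proof.
move=> eps_gt0; have ln2_gt0 : 0 < ln 2 :> R by rewrite ln_gt0 // ltr1n.
have slope_gt0 : 0 < eps / 2 * ln 2 / (`|p| + 1) by rewrite !divr_gt0 ?mulr_gt0.
apply: filterS2 (near_ln_le slope_gt0) (nbhs_infty_ger (2 / eps)) => n ln_le n_ge.
have n_gt0 : (0 < n)%N by rewrite -(ltr_nat R) (lt_le_trans _ n_ge) // divr_gt0.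
have {}n_ge : 2 <= eps * n%:R by rewrite mulrC -ler_pdivrMr.
have {}ln_le : (`|p| + 1) * log n <= eps / 2 * n%:R * ln 2.
  rewrite [leRHS](_ : _ = (`|p| + 1) * (eps / 2 * ln 2 / (`|p| + 1) * n%:R)) ?ler_pM2l //.
  by field; rewrite gt_eqF.
rewrite powR_natr // -[X in _ <= X ^+ _]lnK ?posrE // -expRM_natl ler_expR.
apply: le_trans (le_trans ln_le _).
  by rewrite ler_wpM2r ?ln_natr_ge0 // (le_trans (ler_norm p)) // lerDl.
rewrite ler_wpM2r ?(ltW ln2_gt0) //.
by have := truncnS_gt (eps * n%:R); rewrite -[ltRHS]natr1; lra.
Qed.

Lemma near_growth_le c C (g p : R) : 0 <= c -> 0 <= g -> 2 * c * g < p ->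
  \forall n \near \oo, forall m k r, m%:R <= C * nlogn n -> k%:R <= c * nlogn n ->
    0 <= r <= g * n%:R ->
    (m < 'C(n, 2))%N /\ expR (k%:R * (r / ('C(n, 2) - m)%:R)) <= n%:R `^ p.
Proof.
move=> c_ge0 g_ge0 p_gt; pose eps := (p - 2 * c * g) / (2 * p).
have cg_ge0 : 0 <= c * g by rewrite mulr_ge0.
have p_gt0 : 0 < p by lra.
have eps_gt0 : 0 < eps by rewrite divr_gt0; lra.
have eps_lt1 : eps < 1 by rewrite ltr_pdivrMr; lra.
have eps_cg : 2 * c * g <= p * (1 - eps).
  rewrite mulrBr mulr1 (_ : p * eps = (p - 2 * c * g) / 2); first by lra.
  by rewrite /eps; field; exact: lt0r_neq0.
apply: filterS2 (nbhs_infty_ge 1) (near_pairs_left C eps_gt0 eps_lt1).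
move=> n n_gt0 left_ge m k r /left_ge[m_lt {}left_ge] k_le /andP[r_ge0 r_le].
split=> //; rewrite powR_natr // ler_expR mulrA ler_pdivrMr ?ltr0n ?subn_gt0 //.
apply: le_trans (ler_pM _ _ k_le r_le) _ => //.
have ln_ge0 := ln_natr_ge0 n.
apply: le_trans (ler_wpM2l (mulr_ge0 (ltW p_gt0) ln_ge0) left_ge).
rewrite [leLHS](_ : _ = 2 * c * g * (log n * n%:R ^+ 2 / 2)); last by rewrite /nlogn; field.
rewrite [leRHS](_ : _ = p * (1 - eps) * (log n * n%:R ^+ 2 / 2)); last by field.
by rewrite ler_wpM2r // divr_ge0 // mulr_ge0 // exprn_ge0.
Qed.

Definition rare_below c A := forall c' eta, 0 < c' -> c' < c -> 0 < eta ->
  \forall n \near \oo, forall m, m%:R <= c' * nlogn n.+2 -> pr R m [::] (A n) <= eta.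

(* The bound [C * nlogn] keeps the number of calls well below the number of pairs. *)
Definition rare_above c A := forall c' C eta, c < c' -> 0 < eta ->
  \forall n \near \oo, forall m, c' * nlogn n.+2 <= m%:R <= C * nlogn n.+2 ->
    pr R m [::] (A n) <= eta.

Lemma rare_below_sub c A B : (forall n s, B n s -> A n s) -> rare_below c A -> rare_below c B.
Proof.
move=> BA A_rare c' eta c'_gt0 c'_lt eta_gt0.
apply: filterS (A_rare c' eta c'_gt0 c'_lt eta_gt0) => n bound m /bound; apply: le_trans.
by apply: pr_le => // s _ _; apply: BA.
Qed.

Lemma rare_above_sub c A B : (forall n s, B n s -> A n s) -> rare_above c A -> rare_above c B.
Proof.
move=> BA A_rare c' C eta c'_gt eta_gt0.
apply: filterS (A_rare c' C eta c'_gt eta_gt0) => n bound m /bound; apply: le_trans.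
by apply: pr_le => // s _ _; apply: BA.
Qed.

Lemma near_shift2 (P : set nat) : (\forall n \near \oo, P n) -> \forall n \near \oo, P n.+2.
Proof. exact: cvg_addnl 2 P. Qed.

Lemma rare_below_informed (a b : forall n, 'I_n.+2) : (forall n, a n != b n) ->
  rare_below 2^-1 (fun n s => b n \in spread (a n) s).
Proof.
move=> ab c eta c_gt0 c_lt eta_gt0; pose eps := 2^-1 - c; pose p := 2^-1 + c.
have eps_gt0 : 0 < eps by rewrite /eps; lra.
have p_gt : 2 * c * (1 + eps) < p by rewrite /eps /p; nra.
have slope_ge0 : 0 <= 1 + eps by lra.
apply: filterS2 (near_shift2 (near_growth_le c (ltW c_gt0) slope_ge0 p_gt))
  (near_shift2 (near_powRN_le eps^-1 eps_gt0 eta_gt0)).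
move=> n growth_le powR_le m m_le.
have [|m_lt growth_m_le] := growth_le m m ((1 + eps) * n.+2%:R) m_le m_le.
  by rewrite lexx andbT mulr_ge0.
apply: le_trans powR_le; rewrite -(@ler_pM2l _ (eps * n.+2%:R)) ?mulr_gt0 //.
apply: le_trans (pr_informed eps_gt0 (ab n) m_lt) (le_trans growth_m_le _).
rewrite mulrACA divff ?gt_eqF // mul1r -[X in X * _]powRr1 // -powRD ?pnatr_eq0 ?implybT //.
by rewrite ler_powR ?ler1n // /p /eps; lra.
Qed.

Lemma rare_below_no_uncalled :
  rare_below 2^-1 (fun n s => uncalled s == set0 :> {set 'I_n.+2}).
Proof.
move=> c eta c_gt0 c_lt eta_gt0; pose p := 2^-1 + c; pose gap := 2^-1 - c.
have gap_gt0 : 0 < gap by rewrite subr_gt0.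
have p_gt : 2 * c * 1 < p by rewrite /p; lra.
apply: filterS2 (near_shift2 (near_growth_le c (ltW c_gt0) ler01 p_gt))
  (near_shift2 (near_powRN_le 1 gap_gt0 eta_gt0)).
move=> n growth_le powR_le m m_le.
have [|m_lt growth_m_le] := growth_le m m n.+2%:R m_le m_le; first by rewrite mul1r lexx ler0n.
apply: le_trans (pr_no_uncalled R m_lt) (le_trans _ powR_le).
rewrite ler_pdivrMr // (le_trans growth_m_le) // mul1r.
rewrite -[X in _ * X]powRr1 // -powRD ?pnatr_eq0 ?implybT //.
by rewrite ler_powR ?ler1n // /p /gap; lra.
Qed.

Lemma near_spread_full c C eta : 0 < c -> c < 1 -> 0 < eta ->
  \forall n \near \oo, forall (u : 'I_n.+2) s j, valid s -> u \in uncalled s ->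
    (size s + j)%:R <= C * nlogn n.+2 -> j%:R <= c * nlogn n.+2 ->
    pr R j s (fun s' => spread u s' == setT) <= eta / n.+2%:R.
Proof.
move=> c_gt0 c_lt1 eta_gt0.
have [k k_ge k_gt0] : exists2 k, 1 <= k%:R * (1 - c) & 0 < k%:R :> R.
  exists (Num.truncn (1 - c)^-1).+1 => //.
  by rewrite -ler_pdivrMr ?subr_gt0 // mul1r ltW // truncnS_gt.
pose eps : R := (4 * k%:R)^-1.
have k_eps : k%:R * eps = 4^-1 by rewrite /eps invfM mulrCA divff ?mulr1 // gt_eqF.
have eps_gt0 : 0 < eps by rewrite invr_gt0 mulr_gt0.
have g_ge0 : 0 <= k%:R * (1 + eps) by rewrite mulr_ge0 // addr_ge0 // ltW.
have p_gt : 2 * c * (k%:R * (1 + eps)) < 2 * k%:R - 3 / 2 by rewrite mulrDr k_eps; nra.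
have half_gt0 : 0 < 2^-1 :> R by rewrite invr_gt0.
apply: filterS3 (near_shift2 (near_growth_le C (ltW c_gt0) g_ge0 p_gt))
  (near_shift2 (near_powRN_le (k%:R ^+ k ^+ 2) half_gt0 eta_gt0))
  (near_shift2 (nbhs_infty_ger (k%:R / eps))).
move=> n growth_le powR_le n_ge u s j s_valid u_uncalled sj_le j_le.
have [|sj_lt growth_sj_le] := growth_le _ j (k%:R * (n.+2 + k)%:R) sj_le j_le.
  rewrite mulr_ge0 //= -mulrA ler_wpM2l // natrD mulrDl mul1r lerD2l.
  by rewrite mulrC -ler_pdivrMr.
apply: le_trans (pr_spread_full R k s_valid u_uncalled sj_lt) _.
apply: le_trans (ler_wpM2l _ growth_sj_le) _; first by rewrite !exprn_ge0 // divr_ge0.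
have -> : (k%:R / n.+2%:R) ^+ k ^+ 2 = k%:R ^+ k ^+ 2 * n.+2%:R `^ (- (2 * k%:R)) :> R.
  by rewrite !expr_div_n -[in RHS]natrM powR_invn // mulnC exprM.
rewrite ler_pdivlMr //; apply: le_trans powR_le.
rewrite -2!mulrA ler_wpM2l ?exprn_ge0 // -[X in _ * (_ * X)]powRr1 //.
by rewrite -!powRD ?pnatr_eq0 ?implybT // ler_powR ?ler1n //; lra.
Qed.

Lemma rare_below_some_expert :
  rare_below 1 (fun n s => @some_expert n.+2 (knowledge_after s)).
Proof.
move=> c eta c_gt0 c_lt1 eta_gt0.
apply: filterS (near_spread_full c c_gt0 c_lt1 eta_gt0) => n full_le m m_le.
apply: le_trans (pr_exists R (s := [::]) m (fun u s => expert u (knowledge_after s)) isT) _.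
apply: (@le_trans _ _ (\sum_(u : 'I_n.+2) eta / n.+2%:R)); last first.
  by rewrite sumr_const card_ord -[leLHS]mulr_natr divfK ?pnatr_eq0.
apply: ler_sum => u _.
rewrite -pr_rev; apply: le_trans (full_le u [::] m _ _ _ _) => //; last by rewrite inE.
by apply: pr_le => // s _ _; rewrite /= /expert -spread_rev revK.
Qed.

Lemma rare_below_all_experts :
  rare_below (3 / 2) (fun n s => @all_experts n.+2 (knowledge_after s)).
Proof.
move=> c eta c_gt0 c_lt eta_gt0; pose early := c / 3; pose late := 2^-1 + early.
have [early_gt0 early_lt late_gt0 late_lt1] : [/\ 0 < early, early < 2^-1, 0 < late & late < 1].
  by rewrite /late /early; split; lra.
have half_eta_gt0 : 0 < eta / 2 by rewrite divr_gt0.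
apply: filterS3 (near_spread_full c late_gt0 late_lt1 half_eta_gt0)
  (rare_below_no_uncalled early_gt0 early_lt half_eta_gt0)
  (near_shift2 (filterI (near_nlogn_ge (2^-1 - early)^-1) (near_ltn_bin2 c))) => //.
move=> n full_le uncalled_le [nlogn_ge ltn_bin2] m m_le; have m_lt := ltn_bin2 m m_le.
have /andP[trunc_le trunc_gt] : (Num.truncn (early * nlogn n.+2))%:R <= early * nlogn n.+2
    < (Num.truncn (early * nlogn n.+2)).+1%:R.
  by rewrite truncn_itv // mulr_ge0 ?nlogn_ge0 // ltW.
pose j := minn m (Num.truncn (early * nlogn n.+2)).
have j_le : j%:R <= early * nlogn n.+2.
  by rewrite (le_trans _ trunc_le) // ler_nat geq_minr.
have late_calls_le : (m - j)%:R <= late * nlogn n.+2.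
  rewrite natrB ?geq_minl // /j; case: leqP => _.
    by rewrite subrr mulr_ge0 ?nlogn_ge0 // ltW.
  move: nlogn_ge trunc_gt; rewrite -div1r ler_pdivrMr ?subr_gt0 // -[ltRHS]natr1.
  by rewrite /late /early; lra.
have mE : (j + (m - j))%N = m by rewrite subnKC ?geq_minl.
have full_le_half (s : history n.+2) u : valid s -> size s = j -> u \in uncalled s ->
    pr R (m - j) s (fun s' => spread u s' == setT) <= eta / 2.
  move=> s_valid s_size u_uncalled; apply: le_trans (full_le u s _ _ _ _ late_calls_le) _ => //.
    by rewrite s_size mE.
  by rewrite ler_piMr ?ltW // invf_lt1 // ltr1n.
have := pr_all_experts_le (ltW half_eta_gt0) _ full_le_half; rewrite mE => /(_ (ltnW m_lt)).
by move=> /le_trans; apply; rewrite [leRHS](splitr eta) lerD2r uncalled_le.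
Qed.

Lemma rare_above_high_degree eps : 0 < eps ->
  rare_above 0 (fun n s => ~~ @low_degree n.+2 (Num.truncn (eps * n.+2%:R)) s).
Proof.
move=> eps_gt0 c C eta c_gt0 eta_gt0; pose p := 2 * `|C| * 1 + 1.
have p_gt : 2 * `|C| * 1 < p by rewrite ltrDl.
apply: filterS3 (near_shift2 (near_growth_le C (normr_ge0 C) ler01 p_gt))
  (near_shift2 (near_powRN_le 1 ltr01 eta_gt0))
  (near_shift2 (near_powR_le_exp2 (p + 2) eps_gt0)).
move=> n growth_le powR_le exp2_ge m /andP[_ m_le].
have m_le_norm : m%:R <= `|C| * nlogn n.+2.
  by rewrite (le_trans m_le) // ler_wpM2r ?nlogn_ge0 // ler_norm.
have [|m_lt growth_m_le] := growth_le m m n.+2%:R m_le m_le_norm.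
  by rewrite mul1r lexx ler0n.
set D := Num.truncn _ in exp2_ge *; rewrite -(@ler_pM2l _ (2 ^+ D)) ?exprn_gt0 //.
apply: le_trans (pr_high_degree R D m_lt) _.
apply: le_trans (ler_wpM2l (ler0n _ _) growth_m_le) _.
apply: le_trans (ler_pM _ _ exp2_ge powR_le); rewrite ?mulr_ge0 ?powR_ge0 // mul1r.
rewrite -[X in X * _]powRr1 // -!powRD ?pnatr_eq0 ?implybT //.
by rewrite ler_powR ?ler1n //; lra.
Qed.

Lemma uninformed_rate_ge n D eps : (2 < n)%N -> 0 < eps -> 0 < 1 - 4 * eps ->
    D%:R <= eps * n%:R ->
  2 * (1 - 4 * eps) <= n%:R * ((1 - eps) * (n%:R - 1 - 2 * D%:R) / 'C(n, 2)%:R).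
Proof.
move=> n_gt2 eps_gt0 eps_lt D_le.
have n_ge3 : 3 <= n%:R :> R by rewrite ler_nat.
rewrite [leRHS](_ : _ = 2 * ((1 - eps) * (n%:R - 1 - 2 * D%:R) / (n%:R - 1))).
  rewrite ler_wpM2l // ler_pdivlMr; last by lra.
  apply: (@le_trans _ _ ((1 - eps) * ((1 - 3 * eps) * (n%:R - 1)))); first by nra.
  by rewrite ler_wpM2l //; [lra | nra].
by rewrite natr_bin2; field; apply/andP; split; apply: lt0r_neq0; lra.
Qed.

Lemma near_uninformed eps c C eta j : 0 < eps -> 0 < c -> j.+1%:R < 2 * c * (1 - 4 * eps) ->
    0 < eta ->
  \forall n \near \oo, forall (a b : 'I_n) m, c * nlogn n <= m%:R <= C * nlogn n ->
    pr R m [::] (fun s => low_degree (Num.truncn (eps * n%:R)) s && (b \notin spread a s))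
    <= eta / n%:R ^+ j.
Proof.
move=> eps_gt0 c_gt0 j_lt eta_gt0; pose gap := 2 * c * (1 - 4 * eps) - j.+1%:R.
have gap_gt0 : 0 < gap by rewrite subr_gt0.
have eps_lt : 0 < 1 - 4 * eps.
  by have := lt_trans (ltr0Sn R j) j_lt; rewrite pmulr_rgt0 // mulr_gt0.
have eps_lt1 : eps < 1 by lra.
apply: filterS3 (near_ltn_bin2 C) (near_powRN_le eps^-1 gap_gt0 eta_gt0)
  (nbhs_infty_ge 3).
move=> n ltn_bin2 powR_le n_gt2 a b m /andP[m_ge m_le]; have m_lt := ltn_bin2 m m_le.
have n_gt0 : (0 < n)%N by apply: leq_trans n_gt2.
have nr_gt0 : 0 < n%:R :> R by rewrite ltr0n.
set D := Num.truncn _.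
have D_le : D%:R <= eps * n%:R by rewrite truncn_le mulr_ge0 // ltW.
have D_lt : (D.*2 < n)%N by rewrite -(ltr_nat R) -mul2n natrM; nra.
apply: le_trans (pr_uninformed a b eps_gt0 eps_lt1 m_lt D_lt) _.
have := uninformed_rate_ge n_gt2 eps_gt0 eps_lt D_le.
set rate := (1 - eps) * _ / _ => rate_ge.
have rate_ge0 : 0 <= rate.
  by rewrite -(pmulr_rge0 _ nr_gt0) (le_trans _ rate_ge) // mulr_ge0 // ltW.
have decay_ge : 2 * c * (1 - 4 * eps) * log n <= m%:R * rate.
  apply: le_trans (ler_wpM2r rate_ge0 m_ge).
  have := ler_wpM2l (mulr_ge0 (ltW c_gt0) (ln_natr_ge0 n)) rate_ge.
  by rewrite /nlogn; lra.
rewrite ler_pdivlMr ?exprn_gt0 //; apply: le_trans powR_le.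
rewrite [n%:R / eps]mulrC -!mulrA ler_wpM2l ?invr_ge0 ?(ltW eps_gt0) //.
rewrite [expR _ * _]mulrC mulrA -exprS -powR_mulrn ?(ltW nr_gt0) // !powR_natr // -expRD.
by rewrite ler_expR /gap; lra.
Qed.

Lemma rare_above_uninformed (I : nat -> finType) (src dst : forall n, I n -> 'I_n.+2)
    (K j : nat) : (forall n, #|I n| <= K * n.+2 ^ j)%N ->
  rare_above (j.+1%:R / 2) (fun n s => [exists i, dst n i \notin spread (src n i) s]).
Proof.
move=> cardI c C eta c_gt eta_gt0.
have c_gt0 : 0 < c by apply: lt_trans c_gt; rewrite divr_gt0.
pose eps := (2 * c - j.+1%:R) / (16 * c).
have eps_gt0 : 0 < eps by rewrite divr_gt0 ?mulr_gt0 // subr_gt0; lra.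
have j_lt : j.+1%:R < 2 * c * (1 - 4 * eps).
  have -> : 2 * c * (1 - 4 * eps) = 2 * c - (2 * c - j.+1%:R) / 2.
    by rewrite /eps; field; rewrite gt_eqF.
  by lra.
have half_eta_gt0 : 0 < eta / 2 by rewrite divr_gt0.
have etaK_gt0 : 0 < eta / 2 / K.+1%:R by rewrite divr_gt0.
apply: filterS2 (rare_above_high_degree eps_gt0 C c_gt0 half_eta_gt0)
  (near_shift2 (near_uninformed C eps_gt0 c_gt0 j_lt etaK_gt0)).
move=> n high_le uninformed_le m m_bounds; set D := Num.truncn _ in high_le uninformed_le.
pose missed i s := low_degree D s && (dst n i \notin spread (src n i) s).
apply: (@le_trans _ _ (pr R m [::]
    [predU (fun s => ~~ low_degree D s) & (fun s => [exists i, missed i s])])).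
  apply: pr_le => // s _ _ /existsP[i dst_out] /=; rewrite -implybE; apply/implyP => low.
  by apply/existsP; exists i; rewrite /missed low.
apply: le_trans (pr_or _ _ _ _ _) _ => //; rewrite [leRHS]splitr lerD ?high_le //.
apply: le_trans (pr_exists R (s := [::]) m missed isT) _.
apply: (@le_trans _ _ (\sum_(i : I n) eta / 2 / K.+1%:R / n.+2%:R ^+ j)).
  by apply: ler_sum => i _; apply: uninformed_le.
rewrite sumr_const -[leLHS]mulr_natr -2!mulrA ler_piMr ?(ltW half_eta_gt0) //.
rewrite mulrA -invfM mulrC ler_pdivrMr ?mulr_gt0 ?exprn_gt0 // mul1r -natrX -natrM ler_nat.
by apply: leq_trans (cardI n) _; rewrite leq_mul2r leqnSn orbT.
Qed.

Lemma aas_asymp_calls_until (Q : forall n, pred (knowledge n.+2)) (c : R) (f : nat -> R) :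
    0 < c -> (forall n, upward (Q n)) ->
    rare_below c (fun n s => Q n (knowledge_after s)) ->
    rare_above c (fun n s => ~~ Q n (knowledge_after s)) ->
    (forall n, f n = c * nlogn n) ->
  aas_asymp (fun n s => calls_until (Q n) s) f.
Proof.
move=> c_gt0 upQ below above fE delta delta_gt0; pose d := Num.min delta 2^-1.
have [d_gt0 d_le_delta d_le_half] : [/\ 0 < d, d <= delta & d <= 2^-1].
  by rewrite lt_min delta_gt0 invr_gt0 ltr0n !ge_min !lexx orbT.
pose lo := (1 - d) * c; pose mid := (1 + d / 2) * c; pose hi := (1 + d) * c.
have [lo_gt0 lo_lt c_lt_mid hi_gt0] : [/\ 0 < lo, lo < c, c < mid & 0 < hi].
  by rewrite /lo /mid /hi; split; nra.
apply/cvgrPdist_le => eps eps_gt0; have half_eps_gt0 : 0 < eps / 2 by rewrite divr_gt0.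
apply: filterS3 (below lo (eps / 2) lo_gt0 lo_lt half_eps_gt0)
  (above mid hi (eps / 2) c_lt_mid half_eps_gt0)
  (near_shift2 (filterI (near_ltn_bin2 hi) (near_nlogn_ge (d / 2 * c)^-1))).
move=> n below_le above_le [ltn_bin2 L_ge].
set L := nlogn n.+2 in below_le above_le ltn_bin2 L_ge.
have L_ge0 : 0 <= L := nlogn_ge0 n.+2.
have trunc_itv x : 0 < x -> (Num.truncn (x * L))%:R <= x * L < (Num.truncn (x * L))%:R + 1.
  by move=> x_gt0; rewrite natr1 truncn_itv // mulr_ge0 // ltW.
move: (trunc_itv lo lo_gt0) (trunc_itv hi hi_gt0).
set i := Num.truncn (lo * L); set j := Num.truncn (hi * L).
move=> /andP[i_le i_gt] /andP[j_le j_gt]; have j_lt := ltn_bin2 j j_le.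
have j_ge : mid * L <= j%:R.
  move: L_ge; rewrite -div1r ler_pdivrMr ?mulr_gt0 // => L_ge.
  by move: j_gt; rewrite /hi /mid; lra.
have i_lt : (i < 'C(n.+2, 2))%N.
  by apply: leq_ltn_trans j_lt; apply: le_truncn; rewrite ler_wpM2r // /lo /hi; nra.
pose within t := (1 - delta) * f n.+2 <= t%:R <= (1 + delta) * f n.+2.
rewrite ger0_norm ?subr_ge0 ?(co_prob_le1 R (fun s => within (calls_until (Q n) s))) //.
rewrite lerBlDr -lerBlDl.
have within_between t : (i < t <= j)%N -> within t.
  rewrite -[(i < t)%N](ler_nat R) -natr1 -(ler_nat R) /within fE -/L => /andP[it tj].
  have dcL_le : d * (c * L) <= delta * (c * L) by rewrite ler_wpM2r // mulr_ge0 // ltW.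
  move: i_gt j_le; rewrite /lo /hi => i_gt j_le; apply/andP; split; lra.
apply: le_trans (co_prob_calls_until_ge R (upQ n) (ltnW i_lt) (ltnW j_lt) within_between).
by have := below_le i i_le; have := above_le j; rewrite j_ge j_le => /(_ isT); lra.
Qed.

Lemma aas_asymp_exchanged (a b : forall n, 'I_n.+2) : (forall n, a n != b n) ->
  aas_asymp (fun n s => calls_until (exchanged (a n) (b n)) s)
    (fun n => 2^-1 * n%:R * ln (n%:R : R)).
Proof.
move=> ab; apply: (aas_asymp_calls_until (c := 2^-1)) => [|n|||n].
- by rewrite invr_gt0.
- exact: upward_exchanged.
- apply: (rare_below_sub _ (rare_below_informed ab)) => n s /andP[_].
  by rewrite mem_spread.
- have := @rare_above_uninformed (fun=> bool) (fun n i => if i then a n else b n)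
    (fun n i => if i then b n else a n) 2 0.
  rewrite mul1r => uninformed_rare.
  apply: (rare_above_sub _ (uninformed_rare _)) => [n s|n]; last by rewrite card_bool.
  rewrite negb_and => /orP[out|out]; apply/existsP.
    by exists false; rewrite mem_spread.
  by exists true; rewrite mem_spread.
- by rewrite mulrA.
Qed.

Lemma rare_above_not_expert (a : forall n, 'I_n.+2) :
  rare_above (1 : R) (fun n s => ~~ expert (a n) (knowledge_after s)).
Proof.
have := @rare_above_uninformed (fun n => 'I_n.+2) (fun n b => b) (fun n _ => a n) 1 1.
rewrite divff ?pnatr_eq0 // => uninformed_rare.
apply: (rare_above_sub _ (uninformed_rare _)) => [n s|n]; last by rewrite card_ord expn1 mul1n.
rewrite /expert -subTset => /subsetPn[b _ b_unknown].
by apply/existsP; exists b; rewrite mem_spread.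
Qed.

Lemma rare_above_not_all_experts :
  rare_above (3 / 2 : R) (fun n s => ~~ @all_experts n.+2 (knowledge_after s)).
Proof.
have uninformed_rare := @rare_above_uninformed (fun n => ('I_n.+2 * 'I_n.+2)%type)
  (fun n p => p.1) (fun n p => p.2) 1 2.
apply: (rare_above_sub _ (uninformed_rare _)) => [n s|n].
  rewrite negb_forall => /existsP[y]; rewrite /expert -subTset => /subsetPn[x _ x_unknown].
  by apply/existsP; exists (x, y); rewrite mem_spread.
by rewrite card_prod card_ord mul1n mulnn.
Qed.

Lemma aas_asymp_some_expert :
  aas_asymp (fun n s => calls_until (@some_expert n.+2) s) (fun n => n%:R * ln (n%:R : R)).
Proof.
apply: (aas_asymp_calls_until (c := 1)) => [|n|||n]; last by rewrite mul1r.
- exact: ltr01.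
- exact: upward_some_expert.
- exact: rare_below_some_expert.
apply: (rare_above_sub _ (rare_above_not_expert (fun=> ord0))) => n s.
by apply: contra => expert0; apply/existsP; exists ord0.
Qed.

Lemma aas_asymp_expert (a : forall n, 'I_n.+2) :
  aas_asymp (fun n s => calls_until (expert (a n)) s) (fun n => n%:R * ln (n%:R : R)).
Proof.
apply: (aas_asymp_calls_until (c := 1)) => [|n|||n]; last by rewrite mul1r.
- exact: ltr01.
- exact: upward_expert.
- apply: (rare_below_sub _ rare_below_some_expert) => n s a_expert.
  by apply/existsP; exists (a n).
exact: rare_above_not_expert.
Qed.

Lemma aas_asymp_all_experts :
  aas_asymp (fun n s => calls_until (@all_experts n.+2) s)
    (fun n => 3 / 2 * n%:R * ln (n%:R : R)).
Proof.
apply: (aas_asymp_calls_until (c := 3 / 2)) => [|n|||n]; last by rewrite mulrA.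
- by rewrite divr_gt0.
- exact: upward_all_experts.
- exact: rare_below_all_experts.
- exact: rare_above_not_all_experts.
Qed.

End Asymptotics.

Theorem theorem6p4 (R : realType) (a b : forall n : nat, 'I_n.+2)
    (hab : forall n : nat, a n != b n) :
  [/\ aas_asymp (fun n s => calls_until (exchanged (a n) (b n)) s)
        (fun n : nat => 2^-1 * n%:R * ln (n%:R : R)),
      aas_asymp (fun n s => calls_until (@some_expert n.+2) s)
        (fun n : nat => n%:R * ln (n%:R : R)),
      aas_asymp (fun n s => calls_until (expert (a n)) s)
        (fun n : nat => n%:R * ln (n%:R : R))
    & aas_asymp (fun n s => calls_until (@all_experts n.+2) s)
        (fun n : nat => 3 / 2 * n%:R * ln (n%:R : R))].
Proof.
split.
- exact: aas_asymp_exchanged hab.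
- exact: aas_asymp_some_expert.
- exact: aas_asymp_expert.
- exact: aas_asymp_all_experts.
Qed.
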